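(* There is an absolute constant $C>0$ such that every partial sign matrix $A\in\{-1,1,*\}^{M\times N}$ with $N\geq 2$ columns (and any number $M\geq 1$ of rows) and $\operatorname{VC}(A)=d$ satisfies $$\operatorname{ind}|S(A)|\leq C\,d\,\log^3 N.$$
   Context: All logarithms are natural, and $\log^3 N=(\log N)^3$. The VC dimension $\operatorname{VC}(A)$ of a partial sign matrix $A$ is the largest $d\geq 0$ such that some $d$ columns of $A$ carry every pattern in $\{-1,1\}^d$ among the rows of $A$ restricted to these $d$ columns. With columns indexed by $[N]=\{1,\dots,N\}$, the sign complex $S(A)$ is the simplicial complex generated by the following simplices on the signed column set $\{1^+,1^-,\dots,N^+,N^-\}$: $$\sigma_r^+=\{i^+:r_i=+1\}\cup\{i^-:r_i=-1\},\qquad \sigma_r^-=-\sigma_r^+,$$ as $r$ ranges over the rows of $A$, where $-$ exchanges $i^+$ and $i^-$ for every $i$. (Columns consisting entirely of $*$ entries contribute no vertices.) Exchanging $i^+$ and $i^-$ defines a free simplicial involution on $S(A)$, and $|S(A)|$ denotes the geometric realization with the induced free involution. A continuous map between spaces with free (fixed-point-free) involutions is equivariant if it commutes with the involutions; spheres carry the antipodal involution. For a space $X$ with a free involution, $\operatorname{ind}X=\min\{k\geq0:\text{there is an equivariant map }X\to S^k\}$, with value $+\infty$ if no such map exists, and $\operatorname{ind}\varnothing=-1$. *)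

(* Defs.v *)
From mathcomp Require Import all_boot all_order all_algebra.
From mathcomp Require Import all_classical all_reals all_analysis.
Set Implicit Arguments.
Unset Strict Implicit.
Unset Printing Implicit Defensive.
Import Order.TTheory GRing.Theory Num.Theory.
Import numFieldNormedType.Exports.
Local Open Scope classical_set_scope.
Local Open Scope ring_scope.

(* Entries of a partial sign matrix: [Some true] is +1, [Some false] is -1 and
   [None] is the undefined entry.  *)
Definition partial_sign := option bool.

Section VC.
Variables (M N : nat) (A : 'M[partial_sign]_(M, N)).

Definition shattered (D : {set 'I_N}) : bool :=
  [forall p : {ffun 'I_N -> bool},
    [exists r : 'I_M, [forall j in D, A r j == Some (p j)]]].

(* The empty set of columns is shattered as soon as M >= 1, so that the
   maximum is then over a nonempty family.  *)
Definition VC : nat := (\max_(D : {set 'I_N} | shattered D) #|D|)%N.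

End VC.

Section SignComplex.
Variable N : nat.

(* (i, true) is the vertex i^+ and (i, false) is the vertex i^-.  *)
Definition signed_column : finType := ('I_N * bool)%type.

Definition antipode (v : signed_column) : signed_column := (v.1, ~~ v.2).

Variables (M : nat) (A : 'M[partial_sign]_(M, N)).

Definition sigma_pos (r : 'I_M) : {set signed_column} :=
  [set v : signed_column | A r v.1 == Some v.2]%SET.

Definition sigma_neg (r : 'I_M) : {set signed_column} :=
  (antipode @: sigma_pos r)%SET.

Definition sign_complex : {set {set signed_column}} :=
  [set s : {set signed_column} | (s != finset.set0) &&
    [exists r : 'I_M, (s \subset sigma_pos r) || (s \subset sigma_neg r)]]%SET.

End SignComplex.
Arguments antipode {N} v.

(* Barycentric coordinates, in R^V with the product topology.  *)
Definition realization (R : realType) (V : finType) (K : {set {set V}}) :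
    set {ptws V -> R} :=
  [set x | [/\ forall v, 0 <= x v, \sum_(v : V) x v = 1
             & [set v : V | x v != 0]%SET \in K]].
Arguments realization R {V} K.

Definition realization_antipode (R : realType) (N : nat)
    (x : {ptws signed_column N -> R}) : {ptws signed_column N -> R} :=
  fun v => x (antipode v).
Arguments realization_antipode : clear implicits.

Definition free_involution (T : topologicalType) (X : set T) (nu : T -> T) :=
  {within X, continuous nu} /\
  (forall x, X x -> [/\ X (nu x), nu (nu x) = x & nu x <> x]).

(* The unit sphere S^k of R^{k+1} for the Euclidean norm (the library norm on
   row vectors is the sup norm).  *)
Definition sphere (R : realType) (k : nat) : set 'rV[R]_k.+1 :=
  [set y | \sum_(i < k.+1) y ord0 i ^+ 2 = 1].
Arguments sphere : clear implicits.

(* Spaces are subsets of an ambient topological space; only the restriction of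
   f (and of the involutions) to X and Y matters.  *)
Definition equivariant_map (T U : topologicalType) (X : set T) (nu : T -> T)
    (Y : set U) (mu : U -> U) (f : T -> U) : Prop :=
  [/\ {within X, continuous f}, forall x, X x -> Y (f x)
    & forall x, X x -> f (nu x) = mu (f x)].

(* [ereal_inf] of a nonempty set of naturals is its minimum, see
   [ind_attained], and [ereal_inf set0 = +oo].  *)
Definition ind (R : realType) (T : topologicalType) (X : set T) (nu : T -> T) :
    \bar R :=
  if `[< X = set0 >] then (-1)%E
  else ereal_inf [set (k%:R)%:E | k in [set k : nat |
         exists f : T -> 'rV[R]_k.+1,
           equivariant_map X nu (sphere R k) -%R f]].
Arguments ind R {T} X nu.

Lemma ind_attained (R : realType) (T : topologicalType) (X : set T)
    (nu : T -> T) (k : nat) (f : T -> 'rV[R]_k.+1) : X !=set0 ->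
  equivariant_map X nu (sphere R k) -%R f ->
  exists (m : nat) (g : T -> 'rV[R]_m.+1),
    ind R X nu = (m%:R)%:E /\ equivariant_map X nu (sphere R m) -%R g.
Proof.
move=> /set0P/eqP X0 fP.
set P := fun k : nat => exists f : T -> 'rV[R]_k.+1,
  equivariant_map X nu (sphere R k) -%R f.
have exP : exists m, `[< P m >] by exists k; apply/asboolP; exists f.
have [m /asboolP[g gP] mmin] := ex_minnP exP.
exists m, g; split=> //; rewrite /ind asboolF//; apply/eqP.
rewrite eq_le; apply/andP; split; first by apply: ereal_inf_lbound; exists m => //; exists g.
apply: le_ereal_inf_tmp => _ [j jP <-].
by rewrite lee_fin ler_nat; apply: mmin; apply/asboolP.
Qed.

Lemma antipodeK (N : nat) : involutive (@antipode N).
Proof. by case=> i b; rewrite /antipode /= negbK. Qed.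

Lemma ptws_continuous (T : topologicalType) (I : eqType)
    (U : topologicalType) (g : T -> {ptws I -> U}) :
  (forall i, continuous (fun x => g x i)) -> continuous g.
Proof.
move=> cg x; apply/cvg_sup => v; apply/cvg_image => [|W Wx].
  by apply/seteqP; split=> // y _; exists (fun=> y).
have xW : nbhs x (fun y => W (g y v)) by exact: cg Wx.
exists ((fun y : I -> U => y v) @^-1` W) => //.
by rewrite image_preimage//; apply/seteqP; split=> // y _; exists (fun=> y).
Qed.

Lemma sign_complex_free_involution (R : realType) (M N : nat)
    (A : 'M[partial_sign]_(M, N)) :
  free_involution (realization R (sign_complex A)) (realization_antipode R N).
Proof.
split.
  apply: continuous_subspaceT; apply: ptws_continuous => v.
  exact: (@proj_continuous _ (fun _ : signed_column N => R) (antipode v)).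
move=> x [x0 x1]; rewrite inE => /andP[sN0 /existsP[r sr]].
have aK := @antipodeK N.
have supp : [set v | realization_antipode R N x v != 0]%SET =
    (antipode @: [set v | x v != 0])%SET.
  apply/setP => v; rewrite inE; apply/idP/imsetP.
    by move=> xv; exists (antipode v); rewrite ?inE ?aK.
  by move=> [w]; rewrite inE => xw ->; rewrite /realization_antipode aK.
split.
- split=> [v||]; first exact: x0.
    by rewrite -x1 [RHS](reindex_inj (inv_inj aK)).
  rewrite supp inE; apply/andP; split.
    by rewrite imset_eq0.
  apply/existsP; exists r; rewrite orbC.
  case/orP: sr => sr; apply/orP; [left|right].
    exact: imsetS.
  apply: (fintype.subset_trans (imsetS _ sr)).
  apply/fintype.subsetP => _ /imsetP[_ /imsetP[w wr ->] ->].
  by rewrite aK.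
- by apply: funext => v; rewrite /realization_antipode aK.
- move=> xx.
  have [v xv] := set0Pn _ sN0.
  have xav : antipode v \in [set v | x v != 0]%SET.
    by rewrite -xx supp imset_f.
  have disj w : w \in sigma_pos A r -> antipode w \notin sigma_pos A r.
    rewrite !inE /antipode /= => /eqP ->.
    by apply/eqP => -[]; case: w.2.
  case/orP: sr => /fintype.subsetP sr.
    by have := disj _ (sr _ xv); rewrite sr.
  have /imsetP[w1 w1r e1] := sr _ xv.
  have /imsetP[w2 w2r e2] := sr _ xav.
  have := disj _ w2r; rewrite -e2 e1 aK => /negP; exact.
Qed.

(* Main.v *)
Require Import Defs.
From mathcomp Require Import all_boot all_order all_algebra.
From mathcomp Require Import all_classical all_reals all_analysis.
From mathcomp Require Import zify ring lra.
Set Implicit Arguments.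
Unset Strict Implicit.
Unset Printing Implicit Defensive.
Import Order.TTheory GRing.Theory Num.Theory.
Import numFieldNormedType.Exports.
Local Open Scope ring_scope.

(** Let [d = VC A] and write [L] for [ln (2 N)].  A point of the realization is a
probability distribution on signed columns whose labels agree with a row or with
the negation of a row.  The index is at most [k] as soon as there are [k + 1]
continuous odd functions on the realization with no common zero ([ind_le]), and
such functions are found by learning a labelling from the distribution, in a way
that is continuous and antipodally symmetric, and by recording random features of
a small sample of what was learned.

Weak learning.  Call a set of columns shattered by a set of rows when these rows
carry all patterns on it.  Restricting the rows to those that answer [b] at a
given column, the numbers of shattered sets for the two values of [b] add up to at
most the original number ([shattered_count_split]).  Predicting the label that
keeps more shattered sets alive therefore halves this number at each mistake; along
[n = 32 d] columns it starts below [2 ^ (8 d)], so at most a quarter of the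
predictions are wrong ([halving_mistakes], [card_small_sets]).  When the [n] signed
columns are drawn independently from a realizable distribution, the column on
which a prediction is tested is a fresh one, and averaging shows that one of the
predictors has error at most [1/4] on the distribution ([weak_learner]).  A
predictor is described by [n] signed columns and a position, so there are only
[exp (O (d L))] of them.  Boosting turns this into one probability distribution on
predictors and their negations whose average label has the right sign, by a margin
[1/8], at all vertices of a given face ([boosting], [face_margin]).

Gluing.  A point [x] of the realization is sent to a mixture of the distributions
chosen for its superlevel sets, weighted by how well these are separated from
their complements.  A vertex of maximal coordinate belongs to all of them, so the
mixture keeps the margin at that vertex ([level_weight_max], [ind_le_of_margin]).

Dimension reduction.  Let [y] be such a mixture and draw [r = O (L ^ 2)] signed
predictors from [y].  The mean of their labels defines a Gibbs distribution on
signed columns with inverse temperature [O (L)]; the odd part of its square root is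
a vector of norm at most [1].  At this temperature the Gibbs distribution of [y]
itself concentrates on columns where the average label is far from [0], hence is far
from its antipode, while sampling changes its square root by a bounded angle on
average.  So two independent samples give positively correlated vectors
([sampled_correlation]).  There are [exp (O (d L ^ 3))] samples in all, hence
[O (d L ^ 3)] random sign projections, truncated to bounded functions, preserve all
these correlations at once ([simultaneous_sampling], [clipped_correlation]).  The
expectation over the sample of each projection is a polynomial in [y], odd under
negation, and the sum of their squares is positive ([separating_forms]). *)

(** * Shattered sets and the halving predictor *)

Section Halving.
Variables (M N : nat) (A : 'M[partial_sign]_(M, N)).

(** The columns are listed by [p], possibly with repetitions, and it is positions in
this list that are shattered: the same [n] positions then serve all lists [p]. *)
Definition shatters n (p : 'I_n -> 'I_N) (V : {set 'I_M}) (J : {set 'I_n}) :=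
  [forall b : {ffun 'I_n -> bool},
    [exists r in V, [forall j in J, A r (p j) == Some (b j)]]].

Definition shattered_count n (p : 'I_n -> 'I_N) (V : {set 'I_M}) : nat :=
  #|[set J | shatters p V J]|.

Definition rows_answering (V : {set 'I_M}) (i : 'I_N) (b : bool) : {set 'I_M} :=
  [set r in V | A r i == Some b]%SET.

Lemma shattersP n (p : 'I_n -> 'I_N) (V : {set 'I_M}) (J : {set 'I_n}) :
  reflect (forall b : {ffun 'I_n -> bool},
             exists2 r, r \in V & forall j, j \in J -> A r (p j) = Some (b j))
          (shatters p V J).
Proof.
apply: (iffP forallP) => sh b.
  have /existsP[r /andP[rV /forallP rJ]] := sh b; exists r => // j jJ.
  by apply/eqP; move: (rJ j); rewrite jJ.
have [r rV rJ] := sh b; apply/existsP; exists r; rewrite rV /=.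
by apply/forallP => j; apply/implyP => jJ; apply/eqP/rJ.
Qed.

Lemma shattersS n (p : 'I_n -> 'I_N) (V W : {set 'I_M}) (J : {set 'I_n}) :
  V \subset W -> shatters p V J -> shatters p W J.
Proof.
move=> /fintype.subsetP VW /shattersP sh; apply/shattersP => b.
by have [r /VW rW rJ] := sh b; exists r.
Qed.

Lemma rows_answering_sub (V : {set 'I_M}) i b : rows_answering V i b \subset V.
Proof. by apply/fintype.subsetP => r; rewrite inE => /andP[]. Qed.

Lemma shattered_countS n (p : 'I_n -> 'I_N) (V W : {set 'I_M}) :
  V \subset W -> (shattered_count p V <= shattered_count p W)%N.
Proof.
move=> VW; apply/subset_leq_card/fintype.subsetP => J; rewrite !inE.
exact: shattersS.
Qed.

(** A set shattered by both families of rows does not contain [j], and adding [j] to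
it gives a set shattered by [V]; this accounts for the sets counted twice. *)
Lemma shattered_count_split n (p : 'I_n -> 'I_N) (V : {set 'I_M}) j :
  (shattered_count p (rows_answering V (p j) true) +
   shattered_count p (rows_answering V (p j) false) <= shattered_count p V)%N.
Proof.
set F := fun b => [set J | shatters p (rows_answering V (p j) b) J]%SET.
rewrite /shattered_count -/(F true) -/(F false) -cardsUI.
have jN b J : J \in F b -> j \notin J.
  rewrite inE => /shattersP /(_ [ffun=> ~~ b])[r]; rewrite inE => /andP[_ /eqP rb] rJ.
  by apply/negP => /rJ; rewrite rb ffunE => -[]; case: b {rb rJ}.
have injF : {in F true :&: F false &, injective (fun J => j |: J)}%SET.
  move=> J J' /setIP[/jN jJ _] /setIP[/jN jJ' _] e.
  by rewrite -(setU1K jJ) -(setU1K jJ') e.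
rewrite -(card_in_imset injF) -cardsUI.
have -> : ((F true :|: F false) :&: [set j |: J | J in F true :&: F false] = finset.set0)%SET.
  apply/setP => J; rewrite [in RHS]inE; apply/negbTE/negP => /setIP[JU /imsetP[J' _ e]].
  have : j \notin J by case/setUP: JU => /jN.
  by rewrite e setU11.
rewrite cards0 addn0; apply/subset_leq_card/fintype.subsetP => J.
case/setUP => [/setUP[]|/imsetP[{}J /setIP[Jt Jf] ->]]; rewrite inE.
- by rewrite inE; apply/shattersS/rows_answering_sub.
- by rewrite inE; apply/shattersS/rows_answering_sub.
apply/shattersP => b.
have Jb : J \in F (b j) by case: (b j).
move: Jb; rewrite inE => /shattersP /(_ b)[r]; rewrite inE => /andP[rV /eqP rb] rJ.
by exists r => // j' /setU1P[->|/rJ].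
Qed.

(** Two positions holding the same column cannot receive different labels, so [p] is
injective on a shattered set. *)
Lemma shatters_card n (p : 'I_n -> 'I_N) (V : {set 'I_M}) (J : {set 'I_n}) :
  shatters p V J -> (#|J| <= VC A)%N.
Proof.
move=> /shattersP sh.
have pinj : {in J &, injective p}.
  move=> j j' jJ j'J e; apply/eqP; apply: contraT => jj'.
  have [r _ rJ] := sh [ffun k => k == j].
  have := rJ _ jJ; rewrite e (rJ _ j'J) !ffunE eqxx => -[ej].
  by rewrite eq_sym ej in jj'.
rewrite -(card_in_imset pinj).
rewrite /VC; apply: (@leq_bigmax_cond _ _ (fun D : {set 'I_N} => #|D|) (p @: J)%SET).
apply/forallP => b; have [r _ rJ] := sh [ffun j => b (p j)].
apply/existsP; exists r; apply/forallP => i; apply/implyP => /imsetP[j jJ ->].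
by rewrite (rJ _ jJ) ffunE.
Qed.

(** Chernoff bound: weighting a set [J] by [16 ^ (n - #|J|)] gives total weight
[17 ^ n], and each small set has weight at least [16 ^ (n - d)]. *)
Lemma card_small_sets d :
  (#|[set J : {set 'I_(32 * d)} | #|J| <= d]%N| <= 2 ^ (8 * d))%N.
Proof.
set n := (32 * d)%N.
have dn : (d <= n)%N by rewrite /n; lia.
have e1 : (\sum_(J : {set 'I_n}) 16 ^ (n - #|J|) = 17 ^ n)%N.
  rewrite (partition_big (fun J : {set 'I_n} => inord #|J| : 'I_n.+1) predT) //=.
  rewrite -[17%N]/(16 + 1)%N expnDn; apply: eq_bigr => k _.
  rewrite (eq_bigl (fun J : {set 'I_n} => #|J| == k)); last first.
    move=> J; apply/eqP/eqP => [<-|e].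
      by rewrite inordK // ltnS -[X in (_ <= X)%N]card_ord max_card.
    by apply: val_inj; rewrite /= inordK e.
  rewrite (eq_bigr (fun=> 16 ^ (n - k))%N); last by move=> J /eqP ->.
  rewrite sum_nat_const exp1n muln1; congr (_ * _)%N.
  rewrite -[n in 'C(n, k)]card_ord -card_draws.
  by apply: eq_card => J; rewrite inE.
have e2 : (#|[set J : {set 'I_n} | #|J| <= d]%N| * 16 ^ (n - d) <= 17 ^ n)%N.
  rewrite -e1 -sum_nat_const [leqRHS](bigID (fun J : {set 'I_n} => (#|J| <= d)%N)) /=.
  apply: leq_trans (leq_addr _ _).
  rewrite (eq_bigl (fun J : {set 'I_n} => (#|J| <= d)%N)); last by move=> J; rewrite inE.
  by apply: leq_sum => J Jd; rewrite leq_exp2l // leq_sub2l.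
have e3 : (17 ^ n <= 2 ^ (8 * d) * 16 ^ (n - d))%N.
  have -> : (n - d = 31 * d)%N by rewrite /n; lia.
  have e4 : (17 ^ 32 <= 2 ^ 8 * 16 ^ 31)%N by lia.
  rewrite /n !expnM -expnMn; move: e4.
  move: (17 ^ 32)%N (2 ^ 8 * 16 ^ 31)%N => a b ab.
  by case: (posnP d) => [->|d0]; rewrite ?expn0 ?leq_exp2r.
by rewrite -(leq_pmul2r (m := 16 ^ (n - d))) ?expn_gt0 // (leq_trans e2).
Qed.
End Halving.

Section Learner.
Variables (M N : nat) (A : 'M[partial_sign]_(M, N)).

Definition rows_up_to n (p : {ffun 'I_n -> signed_column N}) (m : nat) :
    {set 'I_M} :=
  [set r | [forall k : 'I_n, (k < m)%N ==> (A r (p k).1 == Some (p k).2)]]%SET.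

(** The predictor sees the columns [(p k).1] for all [k != j], but only the labels of
the positions before [j]; the column [i] to be labelled takes the place of position
[j].  Among the rows compatible with these labels, it chooses the answer at [i]
that leaves more shattered sets of positions. *)
Definition halving n (p : {ffun 'I_n -> signed_column N}) (j : 'I_n) (i : 'I_N) :=
  let q (k : 'I_n) := if k == j then i else (p k).1 in
  let V := rows_up_to p j in
  (shattered_count A q (rows_answering A V i false)
     <= shattered_count A q (rows_answering A V i true))%N.

Lemma rows_up_toS n (p : {ffun 'I_n -> signed_column N}) (j : 'I_n) :
  rows_up_to p j.+1 = rows_answering A (rows_up_to p j) (p j).1 (p j).2.
Proof.
apply/setP => r; rewrite !inE; apply/forallP/andP => [rj|[/forallP rj rpj] k].
  split; last by have := rj j; rewrite leqnn.
  by apply/forallP => k; apply/implyP => kj; have := rj k; rewrite ltnS (ltnW kj).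
apply/implyP; rewrite ltnS leq_eqVlt => /orP[/eqP/val_inj ->//|kj].
by have := rj k; rewrite kj.
Qed.

(** Each mistake at least halves the number of shattered sets of positions, which
stays positive because the row [r] always remains and shatters the empty set. *)
Lemma halving_mistakes n (p : {ffun 'I_n -> signed_column N}) (r : 'I_M) :
  (forall j, p j \in sigma_pos A r) ->
  (2 ^ #|[set j | halving p j (p j).1 != (p j).2]%SET|
     <= #|[set J : {set 'I_n} | #|J| <= VC A]%N%SET|)%N.
Proof.
move=> pr; set mist := fun j => halving p j (p j).1 != (p j).2.
set q := fun k => (p k).1.
have main m : (m <= n)%N ->
    (2 ^ #|[set j : 'I_n | (j < m)%N && mist j]%SET| *
       shattered_count A q (rows_up_to p m) <= shattered_count A q finset.setT)%N.
  elim: m => [_|m IH mn].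
    rewrite (_ : [set j | _]%SET = finset.set0) ?cards0 ?mul1n.
      exact/shattered_countS/finset.subsetT.
    by apply/setP => j; rewrite !inE.
  pose j := Ordinal mn.
  have [E] : [set i : 'I_n | (i < m.+1)%N && mist i]%SET =
      [set i : 'I_n | (i < m)%N && mist i]%SET :|: (if mist j then [set j] else finset.set0)%SET
      /\ j \notin [set i : 'I_n | (i < m)%N && mist i]%SET.
    split; last by rewrite inE ltnn.
    apply/setP => i; rewrite !inE ltnS leq_eqVlt andb_orl orbC; congr (_ || _).
    have -> : (i == m :> nat) = (i == j) by [].
    case: eqVneq => [->|/negbTE ij]; first by case: ifP => mj; rewrite inE ?mj ?eqxx.
    by case: ifP => mj; rewrite inE ?ij.
  rewrite -[X in rows_up_to p X]/(j.+1) rows_up_toS E => jN.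
  apply: leq_trans (IH (ltnW mn)).
  have split := shattered_count_split A q (rows_up_to p m) j.
  case: ifPn => mj; last first.
    rewrite finset.setU0 leq_pmul2l ?expn_gt0 //.
    exact/shattered_countS/rows_answering_sub.
  rewrite finset.setUC cardsU1 jN add1n expnSr -mulnA leq_pmul2l ?expn_gt0 //.
  apply: leq_trans split; rewrite mul2n -addnn.
  have {mj} : ((shattered_count A q (rows_answering A (rows_up_to p m) (q j) false)
     <= shattered_count A q (rows_answering A (rows_up_to p m) (q j) true))%N) != (p j).2.
    move: mj; rewrite /mist /halving.
    suff -> : (fun k => if k == j then (p j).1 else (p k).1) = q by [].
    by apply: funext => k; rewrite /q; case: eqP => // ->.
  rewrite -/(q j); case: (p j).2; rewrite ?eqb_id.
    by rewrite -ltnNge => /ltnW le; rewrite leq_add2l.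
  by rewrite eqbF_neg negbK => le; rewrite leq_add2r.
have := main n (leqnn n).
rewrite (_ : [set j : 'I_n | (j < n)%N && mist j]%SET = [set j | mist j]%SET); last first.
  by apply/setP => j; rewrite !inE ltn_ord.
move=> le; apply: leq_trans (leq_trans le _).
  rewrite leq_pmulr // /shattered_count card_gt0; apply/set0Pn; exists finset.set0.
  rewrite inE; apply/shattersP => b; exists r => [|j]; last by rewrite inE.
  rewrite inE; apply/forallP => k; apply/implyP => _.
  by have := pr k; rewrite inE.
by apply/subset_leq_card/fintype.subsetP => J; rewrite !inE => /shatters_card.
Qed.

(** The entry of [p] at position [j] is not consulted, so it may serve as an
independent test column. *)
Lemma halving_resample n (p : {ffun 'I_n -> signed_column N}) (j : 'I_n) v i :
  halving [ffun k => if k == j then v else p k] j i = halving p j i.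
Proof.
rewrite /halving; set q := fun k => if _ then _ else _.
have -> : q = fun k => if k == j then i else (p k).1.
  by apply: funext => k; rewrite /q ffunE; case: eqP.
suff -> : rows_up_to [ffun k => if k == j then v else p k] j = rows_up_to p j by [].
apply/setP => r; rewrite !inE; apply: eq_forallb => k; rewrite ffunE.
by case: (k =P j) => // ->; rewrite ltnn.
Qed.

End Learner.

(** If [phi p] does not depend on the entry [p j], testing it on [p j] amounts to
testing it on an independent draw: exchange [p j] with the new draw. *)
Lemma sum_prod_resample (R : realType) (n : nat) (T : finType) (q : T -> R)
    (j : 'I_n) (phi : {ffun 'I_n -> T} -> T -> R) :
  \sum_v q v = 1 ->
  (forall (p : {ffun 'I_n -> T}) v w, phi [ffun k => if k == j then v else p k] w = phi p w) ->
  \sum_(p : {ffun 'I_n -> T}) (\prod_k q (p k)) * phi p (p j) =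
  \sum_(p : {ffun 'I_n -> T}) (\prod_k q (p k)) * \sum_v q v * phi p v.
Proof.
move=> q1 phiE.
pose swap (x : {ffun 'I_n -> T} * T) : {ffun 'I_n -> T} * T :=
  ([ffun k => if k == j then x.2 else x.1 k], x.1 j).
have swapK : involutive swap.
  move=> [p v]; rewrite /swap /=; congr pair; last by rewrite ffunE eqxx.
  by apply/ffunP => k; rewrite !ffunE; case: eqP => [->|].
transitivity (\sum_(x : {ffun 'I_n -> T} * T)
    (\prod_k q (x.1 k)) * q x.2 * phi x.1 (x.1 j)).
  rewrite -(pair_bigA _ (fun (p : {ffun 'I_n -> T}) v => (\prod_k q (p k)) * q v * phi p (p j))) /=.
  apply: eq_bigr => p _; rewrite -[LHS]mul1r -q1 mulr_suml.
  by apply: eq_bigr => v _; ring.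
rewrite (reindex_inj (inv_inj swapK)) /=.
under [RHS]eq_bigr do rewrite mulr_sumr.
rewrite pair_bigA; apply: eq_bigr => -[p v] _ /=.
rewrite ffunE eqxx phiE mulrA; congr (_ * _).
rewrite (bigD1 j) //= [in RHS](bigD1 j) //= ffunE eqxx.
rewrite (eq_bigr (fun k => q (p k))); first by ring.
by move=> k /negbTE kj; rewrite ffunE kj.
Qed.

Lemma mean_gt (R : realType) (T : finType) (W X : T -> R) (a : R) :
  (forall t, 0 <= W t) -> \sum_t W t = 1 -> (forall t, a < X t) ->
  a < \sum_t W t * X t.
Proof.
move=> W0 W1 aX; rewrite -subr_gt0 -[a]mul1r -W1 mulr_suml -sumrB.
have t0 t : 0 <= W t * X t - W t * a.
  by rewrite -mulrBr mulr_ge0 // subr_ge0 ltW.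
rewrite lt_neqAle; apply/andP; split; last by apply: sumr_ge0 => t _; exact: t0.
rewrite eq_sym psumr_eq0; last by move=> t _; exact: t0.
apply/negP.
move=> /allP z; have := oner_neq0 R; rewrite -W1 big1 ?eqxx // => t _.
have := z t (mem_index_enum _); rewrite /= -mulrBr mulf_eq0 subr_eq0.
by rewrite (gt_eqF (aX t)) orbF => /eqP.
Qed.

(** Over a random list of [n] draws from [q], the expected number of mistakes is at
most [8 * VC A], a quarter of [n]; if all predictors had error above [1/4], each
position would contribute more than [1/4]. *)
Lemma weak_learner (R : realType) (M N : nat) (A : 'M[partial_sign]_(M, N))
    (r : 'I_M) (q : signed_column N -> R) (n := (32 * VC A)%N) :
  (0 < VC A)%N -> (forall v, 0 <= q v) -> \sum_v q v = 1 ->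
  (forall v, q v != 0 -> v \in sigma_pos A r) ->
  exists (c : {ffun 'I_n -> signed_column N} * 'I_n),
    \sum_v q v * (halving A c.1 c.2 v.1 != v.2)%:R <= 4%:R^-1.
Proof.
move=> d0 q0 q1 qr; apply/not_existsP => bad.
pose err (p : {ffun 'I_n -> signed_column N}) (j : 'I_n) (v : signed_column N) : R :=
  (halving A p j v.1 != v.2)%:R.
pose W (p : {ffun 'I_n -> signed_column N}) := \prod_k q (p k).
have W0 p : 0 <= W p by apply: prodr_ge0.
have W1 : \sum_p W p = 1.
  rewrite -(bigA_distr_bigA (fun _ => q)) /=.
  by rewrite big1 // => k _; rewrite q1.
have up : \sum_p W p * \sum_j err p j (p j) <= (8 * VC A)%:R.
  have [e ee] : {e : R | e = (8 * VC A)%:R} by exists (8 * VC A)%:R.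
  rewrite -ee.
  rewrite -[e]mul1r -W1 mulr_suml; apply: ler_sum => p _.
  have [->|Wp] := eqVneq (W p) 0; first by rewrite !mul0r.
  apply: ler_wpM2l => //; rewrite ee /err -natr_sum. rewrite ler_nat.
  have pr k : p k \in sigma_pos A r.
    by apply: qr; move: Wp => /prodf_neq0; apply.
  rewrite -(@leq_exp2l 2) //; apply: leq_trans (card_small_sets _).
  apply: leq_trans (halving_mistakes pr).
  rewrite leq_exp2l // -sum1_card [leqRHS]big_mkcond /=. apply: leq_sum => j _.
  by rewrite inE; case: (_ != _).
have low : (32 * VC A)%:R * 4%:R^-1 < \sum_p W p * \sum_j err p j (p j).
  under eq_bigr do rewrite mulr_sumr.
  rewrite exchange_big /=.
  have -> : (32 * VC A)%:R * 4%:R^-1 = \sum_(j < n) 4%:R^-1 :> R.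
    by rewrite sumr_const card_ord mulr_natl.
  have n0 : (0 < n)%N by rewrite muln_gt0.
  apply: ltr_sum => [|j _].
    by apply/hasP; exists (Ordinal n0); rewrite ?mem_index_enum.
  rewrite (sum_prod_resample (j := j) (phi := fun p => err p j)) //.
    apply: mean_gt => // p; rewrite ltNge; apply/negP => le.
    exact: (bad (p, j)).
  by move=> p v w; rewrite /err halving_resample.
move: (lt_le_trans low up); rewrite natrM [ (8 * _)%:R]natrM.
lra.
Qed.

(** * Boosting *)

(** From [expR x = expR (x / 2) ^+ 2] and [expR (- x / 2) >= 1 - x / 2]. *)
Lemma expR_le_quadratic (R : realType) (x : R) :
  `|x| <= 3%:R^-1 -> expR x <= 1 + x + x ^+ 2.
Proof.
rewrite ler_norml => /andP[xl xu].
have e0 : 0 < 1 - x / 2%:R by lra.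
have e1 : expR (x / 2%:R) <= (1 - x / 2%:R)^-1.
  have -> : expR (x / 2%:R) = (expR (- (x / 2%:R)))^-1 by rewrite expRN invrK.
  rewrite lef_pV2 ?posrE ?expR_gt0 //.
  exact: expR_ge1Dx.
have e2 : expR x <= (1 - x / 2%:R)^-1 ^+ 2.
  have -> : expR x = expR (x / 2%:R) ^+ 2 by rewrite -expRM_natl; congr expR; lra.
  by apply: lerXn2r => //; rewrite nnegrE ?expR_ge0 ?invr_ge0 ?(ltW e0).
apply: le_trans e2 _; rewrite exprVn -div1r ler_pdivrMr ?exprn_gt0 //.
nra.
Qed.

Section Boosting.
Variables (R : realType) (V I : finType) (S : {set V}) (m : I -> V -> R).
Hypothesis m1 : forall c v, `|m c v| <= 1.
Hypothesis S0 : (0 < #|S|)%N.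
Hypothesis weak : forall q : V -> R, (forall v, 0 <= q v) -> \sum_v q v = 1 ->
  (forall v, q v != 0 -> v \in S) -> exists c, 2%:R^-1 <= \sum_v q v * m c v.

(** Multiplicative weights with step [1/4]: each round adds a hypothesis that has
correlation at least [1/2] with the current weights, which multiplies the
exponential loss by at most [1 - 1/8 + 1/16]. *)
Lemma boosting_rounds t : exists y : I -> R,
  [/\ forall c, 0 <= y c, \sum_c y c = t%:R &
    \sum_(v in S) expR (- (\sum_c y c * m c v) / 4%:R)
      <= #|S|%:R * (15%:R / 16%:R) ^+ t].
Proof.
elim: t => [|t [y [y0 yt ybd]]].
  exists (fun=> 0); split=> //; first by rewrite big1.
  rewrite expr0 mulr1 -sumr_const; apply: ler_sum => v _.
  by rewrite big1 ?oppr0 ?mul0r ?expR0 // => c _; rewrite mul0r.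
pose E v := expR (- (\sum_c y c * m c v) / 4%:R).
pose Z := \sum_(v in S) E v.
have Z0 : 0 < Z.
  have /card_gt0P[v vS] := S0.
  rewrite /Z (bigD1 v) //= ltr_pwDl ?expR_gt0 // sumr_ge0 // => *.
  exact: expR_ge0.
pose q v := if v \in S then E v / Z else 0.
have qE (f : V -> R) : \sum_v q v * f v = (\sum_(v in S) E v * f v) / Z.
  rewrite mulr_suml [RHS]big_mkcond; apply: eq_bigr => v _.
  by rewrite /q; case: ifP => _; rewrite ?mul0r // mulrAC.
have [|||c cq] := weak (q := q).
- by move=> v; rewrite /q; case: ifP => // _; rewrite divr_ge0 ?expR_ge0 ?ltW.
- by have := qE (fun=> 1); under eq_bigr do rewrite mulr1; move=> ->;
    under eq_bigr do rewrite mulr1; rewrite divff // gt_eqF.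
- by move=> v; rewrite /q; case: ifP; rewrite ?eqxx.
exists (fun c' => y c' + (c' == c)%:R); split.
- by move=> c'; rewrite addr_ge0.
- rewrite big_split /= yt -natr1; congr (_ + _).
  by rewrite (bigD1 c) //= eqxx big1 ?addr0 // => i /negbTE ->.
have step v : v \in S ->
    expR (- (\sum_c' (y c' + (c' == c)%:R) * m c' v) / 4%:R) <=
    E v * (17%:R / 16%:R) - E v * m c v / 4%:R.
  move=> vS; have -> : \sum_c' (y c' + (c' == c)%:R) * m c' v =
      \sum_c' y c' * m c' v + m c v.
    under eq_bigr do rewrite mulrDl.
    rewrite big_split /=; congr (_ + _).
    by rewrite (bigD1 c) //= eqxx mul1r big1 ?addr0 // => i /negbTE ->; rewrite mul0r.
  rewrite opprD mulrDl expRD -/(E v).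
  have -> : E v * (17%:R / 16%:R) - E v * m c v / 4%:R =
    E v * (17%:R / 16%:R - m c v / 4%:R) by ring.
  rewrite ler_wpM2l ?expR_ge0 //.
  have := m1 c v; rewrite ler_norml => /andP[ml mu].
  apply: le_trans (expR_le_quadratic _) _; first by rewrite ler_norml; lra.
  nra.
apply: le_trans (ler_sum _ step) _.
rewrite sumrB -!mulr_suml -/Z.
move: cq; rewrite qE ler_pdivlMr // => cq.
rewrite exprS [leRHS]mulrCA.
apply: le_trans (_ : 15%:R / 16%:R * Z <= _); last by apply: ler_wpM2l => //; lra.
lra.
Qed.

(** After [32 * #|S|] rounds the exponential loss is so small that no element of [S]
can have margin below [1/8]. *)
Lemma boosting : exists y : I -> R,
  [/\ forall c, 0 <= y c, \sum_c y c = 1 &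
    forall v, v \in S -> 8%:R^-1 <= \sum_c y c * m c v].
Proof.
pose t := (32 * #|S|)%N.
have t0 : 0 < t%:R :> R by rewrite ltr0n muln_gt0.
have [y [y0 yt ybd]] := boosting_rounds t.
exists (fun c => y c / t%:R); split.
- by move=> c; rewrite divr_ge0 // ltW.
- by rewrite -mulr_suml yt divff // gt_eqF.
move=> v vS; have -> : \sum_c y c / t%:R * m c v = (\sum_c y c * m c v) / t%:R.
  by rewrite mulr_suml; apply: eq_bigr => c _; rewrite mulrAC.
rewrite ler_pdivlMr // leNgt; apply/negP => lt.
set mt := \sum_c y c * m c v in lt.
have e1 : expR (- mt / 4%:R) <= #|S|%:R * expR (- t%:R / 16%:R).
  apply: le_trans (le_trans ybd _).
    rewrite (bigD1 v) //= -/mt lerDl sumr_ge0 // => *; exact: expR_ge0.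
  rewrite ler_wpM2l //.
  have -> : expR (- t%:R / 16%:R) = expR (- 16%:R^-1) ^+ t :> R.
    by rewrite -expRM_natl; congr expR; lra.
  have le : 15%:R / 16%:R <= expR (- 16%:R^-1) :> R.
    by apply: le_trans (expR_ge1Dx _); lra.
  by apply: lerXn2r => //; rewrite nnegrE ?expR_ge0 //; lra.
have e2 : expR (- t%:R / 32%:R) < #|S|%:R * expR (- t%:R / 16%:R) :> R.
  by apply: lt_le_trans e1; rewrite ltr_expR; lra.
have e3 : expR (#|S|%:R) < #|S|%:R :> R.
  have -> : #|S|%:R = t%:R / 32%:R :> R by rewrite /t natrM; lra.
  have p : 0 < expR (- t%:R / 16%:R) :> R by exact: expR_gt0.
  rewrite -(ltr_pM2r p) -expRD.
  have -> : t%:R / 32%:R + - t%:R / 16%:R = - t%:R / 32%:R :> R by lra.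
  by apply: lt_le_trans e2 _; rewrite /t natrM; lra.
have := expR_ge1Dx (#|S|%:R : R); lra.
Qed.
End Boosting.

(** * Gibbs vectors of sampled labellings *)

Section Sampling.
Variables (R : realType) (N : nat) (Om : finType) (h : Om -> 'I_N -> bool).

(** The label that [h w] gives to the column of [v], as a sign relative to the label
carried by [v]. *)
Definition agreement (w : Om) (v : signed_column N) : R :=
  if h w v.1 == v.2 then 1 else -1.

Lemma agreement_antipode w v : agreement w (antipode v) = - agreement w v.
Proof.
by rewrite /agreement /=; case: (h w v.1); case: v.2; rewrite /= ?opprK.
Qed.

Lemma agreement_norm w v : `|agreement w v| = 1.
Proof. by rewrite /agreement; case: ifP; rewrite ?normrN normr1. Qed.

Variable eta : R.

Definition partition_function (f : signed_column N -> R) : R :=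
  \sum_v expR (eta * f v).

(** The square root of the Gibbs probability of [v].  The logarithm is kept in the exponent so that products of two
such roots are single exponentials. *)
Definition gibbs_root (f : signed_column N -> R) (v : signed_column N) : R :=
  expR ((eta * f v - ln (partition_function f)) / 2%:R).

(** The odd part of the square root: it vanishes where the two labels of a column are
equally likely. *)
Definition gibbs_vector (f : signed_column N -> R) (i : 'I_N) : R :=
  gibbs_root f (i, true) - gibbs_root f (i, false).

Lemma partition_function_ge f (v : signed_column N) : expR (eta * f v) <= partition_function f.
Proof.
rewrite /partition_function (bigD1 v) //= lerDl sumr_ge0 // => *; exact: expR_ge0.
Qed.

Lemma partition_function_gt0 f (v : signed_column N) : 0 < partition_function f.
Proof. by apply: lt_le_trans (partition_function_ge f v); apply: expR_gt0. Qed.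

Lemma gibbs_root_sqr f (v : signed_column N) :
  gibbs_root f v ^+ 2 = expR (eta * f v) / partition_function f.
Proof.
rewrite /gibbs_root -expRM_natl mulrC divfK // expRD expRN.
by rewrite lnK // posrE (partition_function_gt0 f v).
Qed.

Lemma gibbs_root_sum (v0 : signed_column N) f : \sum_v gibbs_root f v ^+ 2 = 1.
Proof.
under eq_bigr do rewrite gibbs_root_sqr.
by rewrite -mulr_suml divff // gt_eqF // (partition_function_gt0 f v0).
Qed.

Lemma sum_signed_column (F : signed_column N -> R) :
  \sum_v F v = \sum_i (F (i, true) + F (i, false)).
Proof.
rewrite (eq_bigr (fun v => F (v.1, v.2))); last by case.
rewrite -(pair_bigA _ (fun i b => F (i, b))) /=.
by apply: eq_bigr => i _; rewrite big_bool.
Qed.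

(** The cross terms lost when the roots at [(i, true)] and [(i, false)] are
subtracted are nonnegative. *)
Lemma gibbs_vector_norm (v0 : signed_column N) f : \sum_i gibbs_vector f i ^+ 2 <= 1.
Proof.
rewrite -(gibbs_root_sum v0 f) sum_signed_column; apply: ler_sum => i _.
rewrite /gibbs_vector.
have p := expR_ge0 ((eta * f (i, true) - ln (partition_function f)) / 2%:R).
have q := expR_ge0 ((eta * f (i, false) - ln (partition_function f)) / 2%:R).
rewrite -/(gibbs_root f (i, true)) in p; rewrite -/(gibbs_root f (i, false)) in q.
nra.
Qed.

Lemma gibbs_vector_dot f g :
  \sum_i gibbs_vector f i * gibbs_vector g i =
  \sum_v gibbs_root f v * gibbs_root g v -
  \sum_v gibbs_root f v * gibbs_root g (antipode v).
Proof.
rewrite -sumrB sum_signed_column; apply: eq_bigr => i _.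
rewrite /gibbs_vector /antipode /=.
move: (gibbs_root f (i, true)) (gibbs_root f (i, false)).
by move: (gibbs_root g (i, true)) (gibbs_root g (i, false)) => a b c d; ring.
Qed.

Lemma gibbs_vector_odd f g : (forall v, g v = f (antipode v)) ->
  forall i, gibbs_vector g i = - gibbs_vector f i.
Proof.
move=> gf i; rewrite /gibbs_vector opprB.
have Zfg : partition_function g = partition_function f.
  rewrite /partition_function [RHS](reindex_inj (inv_inj (@antipodeK N))).
  by apply: eq_bigr => v _; rewrite gf.
by rewrite /gibbs_root Zfg !gf.
Qed.

Variables (y : Om -> R) (r : nat).
Hypothesis y0 : forall w, 0 <= y w.
Hypothesis y1 : \sum_w y w = 1.

Definition sample_weight (H : {ffun 'I_r -> Om}) : R := \prod_j y (H j).

Definition sample_mean (H : {ffun 'I_r -> Om}) (v : signed_column N) : R :=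
  (\sum_j agreement (H j) v) / r%:R.

Definition mean_agreement (v : signed_column N) : R := \sum_w y w * agreement w v.

Lemma sample_weight_ge0 H : 0 <= sample_weight H.
Proof. by apply: prodr_ge0. Qed.

Lemma sample_weight_sum : \sum_H sample_weight H = 1.
Proof.
rewrite -(bigA_distr_bigA (fun _ => y)) /=.
by rewrite big1 // => k _; rewrite y1.
Qed.

(** Independence of the draws. *)
Lemma sample_expectation_prod (F : 'I_r -> Om -> R) :
  \sum_H sample_weight H * \prod_j F j (H j) = \prod_j \sum_w y w * F j w.
Proof.
rewrite (bigA_distr_bigA (fun j w => y w * F j w)) /=.
by apply: eq_bigr => H _; rewrite -big_split.
Qed.

Lemma sample_coordinate_expectation (j : 'I_r) (phi : Om -> R) :
  \sum_H sample_weight H * phi (H j) = \sum_w y w * phi w.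
Proof.
transitivity (\sum_H sample_weight H * \prod_k (if k == j then phi (H k) else 1)).
  by apply: eq_bigr => H _; rewrite -big_mkcond big_pred1_eq.
rewrite (sample_expectation_prod (fun k w => if k == j then phi w else 1)).
rewrite (bigD1 j) //= eqxx [X in _ * X = _]big1 ?mulr1 // => k /negbTE ->.
by under eq_bigr do rewrite mulr1.
Qed.

Lemma sample_mean_expectation v : (0 < r)%N ->
  \sum_H sample_weight H * sample_mean H v = mean_agreement v.
Proof.
move=> r0; under eq_bigr do rewrite /sample_mean mulrA mulr_sumr.
rewrite -mulr_suml exchange_big /=.
rewrite (eq_bigr (fun=> mean_agreement v)); last first.
  by move=> j _; exact: sample_coordinate_expectation.
rewrite sumr_const card_ord -[X in X / _]mulr_natr mulfK //.
by rewrite pnatr_eq0 -lt0n.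
Qed.

(** Each draw contributes a factor [1 + (th / r) m + (th / r) ^+ 2] at most, where [m]
is the mean agreement. *)
Lemma sample_mean_mgf (th : R) v : (0 < r)%N -> `|th| <= r%:R / 3%:R ->
  \sum_H sample_weight H * expR (th * sample_mean H v)
    <= expR (th * mean_agreement v + th ^+ 2 / r%:R).
Proof.
move=> r0 thr; have r0' : 0 < r%:R :> R by rewrite ltr0n.
have -> : \sum_H sample_weight H * expR (th * sample_mean H v) =
    (\sum_w y w * expR (th / r%:R * agreement w v)) ^+ r.
  have := sample_expectation_prod (fun _ w => expR (th / r%:R * agreement w v)).
  rewrite prodr_const card_ord => <-.
  apply: eq_bigr => H _; congr (_ * _).
  rewrite -expR_sum -mulr_sumr /sample_mean; congr expR; by field; rewrite gt_eqF.
have -> : expR (th * mean_agreement v + th ^+ 2 / r%:R) =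
    expR (th / r%:R * mean_agreement v + (th / r%:R) ^+ 2) ^+ r.
  rewrite -expRM_natl; congr expR; by field; rewrite gt_eqF.
have n1 : `|th / r%:R| <= 3%:R^-1.
  rewrite normrM (gtr0_norm (_ : 0 < r%:R^-1)) ?invr_gt0 // ler_pdivrMr //.
  by rewrite mulrC.
apply: lerXn2r; rewrite ?nnegrE ?expR_ge0 //.
  by apply: sumr_ge0 => w _; rewrite mulr_ge0 ?expR_ge0.
apply: le_trans (expR_ge1Dx _).
rewrite addrA /mean_agreement.
have -> : 1 + th / r%:R * \sum_w y w * agreement w v + (th / r%:R) ^+ 2 =
  \sum_w y w * (1 + th / r%:R * agreement w v + (th / r%:R) ^+ 2).
  under [RHS]eq_bigr do rewrite 2!mulrDr mulr1 mulrCA.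
  by rewrite !big_split /= y1 -mulr_sumr -mulr_suml y1 mul1r.
apply: ler_sum => w _; rewrite ler_wpM2l //.
apply: le_trans (expR_le_quadratic _) _.
  by rewrite normrM agreement_norm mulr1.
rewrite lerD2l exprMn -[_ ^+ 2 * _]mulr1.
have -> : agreement w v ^+ 2 = 1 by rewrite -real_normK ?num_real // agreement_norm expr1n.
by rewrite !mulr1.
Qed.

(** With [r] of order [eta ^+ 2], the fluctuations of [eta * sample_mean] are of
order [1]. *)
Hypothesis eta1 : 1 <= eta.
Hypothesis r_large : 4%:R * eta ^+ 2 <= r%:R.

Let r_gt0 : (0 < r)%N.
Proof. rewrite -(ltr0n R); apply: lt_le_trans r_large.
by rewrite mulr_gt0 ?ltr0n // exprn_gt0 //; apply: lt_le_trans eta1.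
Qed.

Let small_slope (th : R) : 0 <= th -> th <= eta -> `|th| <= r%:R / 3%:R.
Proof. move=> t0 te; rewrite ger0_norm // ler_pdivlMr //.
have := eta1; have := r_large; 
move=> rl e1; apply: le_trans rl; nra.
Qed.

Lemma expected_partition_function :
  \sum_H sample_weight H * partition_function (sample_mean H)
    <= 21%:R / 16%:R * partition_function mean_agreement.
Proof.
under eq_bigr do rewrite mulr_sumr.
rewrite exchange_big /= mulr_sumr; apply: ler_sum => v _.
apply: le_trans (sample_mean_mgf v r_gt0 (small_slope _ _)) _ => //.
  by apply: le_trans eta1.
rewrite expRD mulrC ler_wpM2r ?expR_ge0 //.
have r0 : 0 < r%:R :> R by rewrite ltr0n.
have e4 : eta ^+ 2 / r%:R <= 4%:R^-1 by rewrite ler_pdivrMr //; have := r_large; lra.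
apply: le_trans (_ : expR 4%:R^-1 <= _); first by rewrite ler_expR.
apply: le_trans (expR_le_quadratic _) _; last lra.
by rewrite ger0_norm; lra.
Qed.

(** The Bhattacharyya coefficient of the sampled and the true Gibbs distribution is
the expectation, under the true one, of an exponential; bounding [expR t] below by
[1 + t] leaves a term linear in the sample mean, which averages to zero, and the
logarithm of the ratio of the partition functions, which
[expected_partition_function] controls. *)
Lemma expected_overlap (v0 : signed_column N) :
  27%:R / 32%:R <= \sum_H sample_weight H *
    \sum_v gibbs_root (sample_mean H) v * gibbs_root mean_agreement v.
Proof.
set m := mean_agreement; set Z0 := partition_function m.
have Z0p : 0 < Z0 by exact: (partition_function_gt0 m v0).
pose low (H : {ffun 'I_r -> Om}) := \sum_v gibbs_root m v ^+ 2 *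
  (1 + (eta * sample_mean H v - eta * m v) / 2%:R +
   (1 - partition_function (sample_mean H) / Z0) / 2%:R).
apply: (@le_trans _ _ (\sum_H sample_weight H * low H)); last first.
  apply: ler_sum => H _; apply: ler_wpM2l; first exact: sample_weight_ge0.
  apply: ler_sum => v _; set ZH := partition_function (sample_mean H).
  have ZHp : 0 < ZH by exact: (partition_function_gt0 _ v).
  have -> : gibbs_root (sample_mean H) v * gibbs_root m v = gibbs_root m v ^+ 2 *
      expR ((eta * sample_mean H v - eta * m v) / 2%:R + (ln Z0 - ln ZH) / 2%:R).
    rewrite /gibbs_root -/ZH -/Z0 -expRM_natl -!expRD; congr expR; lra.
  apply: ler_wpM2l; first exact: sqr_ge0.
  apply: le_trans (expR_ge1Dx _); rewrite -addrA !lerD2l ler_wpM2r //.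
  have q : 0 < ZH / Z0 by rewrite divr_gt0.
  have := le_ln1Dx (x := ZH / Z0 - 1); rewrite addrCA subrr addr0 ln_div ?posrE //.
  by move=> le; have := le ltac:(lra); lra.
have -> : \sum_H sample_weight H * low H = 3%:R / 2%:R -
    (\sum_H sample_weight H * partition_function (sample_mean H)) / Z0 / 2%:R.
  (* the total mass 1 of the squared roots absorbs the constant terms *)
  have lowE H : low H = 3%:R / 2%:R - partition_function (sample_mean H) / Z0 / 2%:R +
      \sum_v gibbs_root m v ^+ 2 * (eta / 2%:R) * (sample_mean H v - m v).
    have -> : 3%:R / 2%:R - partition_function (sample_mean H) / Z0 / 2%:R =
        \sum_v gibbs_root m v ^+ 2 *
          (3%:R / 2%:R - partition_function (sample_mean H) / Z0 / 2%:R).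
      by rewrite -mulr_suml (gibbs_root_sum v0) mul1r.
    by rewrite -big_split; apply: eq_bigr => v _ /=; field; rewrite gt_eqF.
  under eq_bigr do rewrite lowE mulrDr mulrBr.
  rewrite big_split sumrB /= -mulr_suml sample_weight_sum mul1r.
  under [X in _ - X]eq_bigr do rewrite !mulrA.
  rewrite -!mulr_suml.
  rewrite [X in _ + X](_ : _ = 0) ?addr0 //.
  under eq_bigr do rewrite mulr_sumr.
  rewrite exchange_big /= big1 // => v _.
  under eq_bigr do rewrite mulrCA mulrBr.
  rewrite -mulr_sumr sumrB -mulr_suml sample_weight_sum mul1r.
  by rewrite sample_mean_expectation // subrr mulr0.
have : (\sum_H sample_weight H * partition_function (sample_mean H)) / Z0 <= 21%:R / 16%:R.
  by rewrite ler_pdivrMr // expected_partition_function.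
lra.
Qed.

(** The margin at [v0] makes the true partition function exponentially large, while
the antipodal overlap has only [2 N] terms, each bounded on average. *)
Lemma expected_antipodal_overlap (v0 : signed_column N) :
  8%:R^-1 <= mean_agreement v0 -> 32%:R * N%:R <= expR (eta / 16%:R) ->
  \sum_H sample_weight H *
    \sum_v gibbs_root (sample_mean H) v * gibbs_root mean_agreement (antipode v)
   <= 273%:R / 4096%:R.
Proof.
move=> mv0 large; set m := mean_agreement.
have Zm : eta / 8%:R <= ln (partition_function m).
  rewrite -[leLHS]expRK ler_ln ?posrE ?expR_gt0 ?(partition_function_gt0 _ v0) //.
  apply: le_trans (partition_function_ge m v0); rewrite ler_expR.
  by apply: ler_wpM2l => //; apply: le_trans eta1.
have ZH H : 0 <= ln (partition_function (sample_mean H)).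
  apply: ln_ge0; pose v := if 0 <= sample_mean H v0 then v0 else antipode v0.
  apply: le_trans (partition_function_ge _ v).
  rewrite -expR0 ler_expR mulr_ge0 //; first exact: le_trans eta1.
  rewrite /v; case: (leP 0 (sample_mean H v0)) => // lt0.
  rewrite /sample_mean; under eq_bigr do rewrite agreement_antipode.
  by rewrite sumrN mulNr oppr_ge0 ltW.
have mA v : m (antipode v) = - m v.
  by rewrite /m /mean_agreement -sumrN; apply: eq_bigr => w _; rewrite agreement_antipode mulrN.
under eq_bigr do rewrite mulr_sumr.
rewrite exchange_big /=.
apply: (@le_trans _ _ (\sum_(v : signed_column N) expR (16%:R^-1) * expR (- (eta / 16%:R)))).
  apply: ler_sum => v _.
  apply: (@le_trans _ _ (\sum_H sample_weight H * expR (eta / 2%:R * sample_mean H v) *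
      expR (- (eta / 2%:R * m v) - eta / 16%:R))).
    apply: ler_sum => H _; rewrite -mulrA; apply: ler_wpM2l; first exact: sample_weight_ge0.
    rewrite /gibbs_root mA -!expRD ler_expR; have := ZH H; lra.
  rewrite -mulr_suml.
  have r0 : 0 < r%:R :> R by rewrite ltr0n.
  have th : `|eta / 2%:R| <= r%:R / 3%:R by apply: small_slope; have := eta1; lra.
  apply: le_trans (ler_wpM2r (expR_ge0 _) (sample_mean_mgf v r_gt0 th)) _.
  rewrite -!expRD ler_expR -/m.
  have e16 : (eta / 2%:R) ^+ 2 / r%:R <= 16%:R^-1.
    by rewrite ler_pdivrMr //; have := r_large; lra.
  lra.
rewrite sumr_const card_prod card_ord card_bool -[leLHS]mulr_natr natrM.
have e1 : expR 16%:R^-1 <= 273%:R / 256%:R :> R.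
  by apply: le_trans (expR_le_quadratic _) _; rewrite ?ger0_norm; lra.
have e2 : expR (- (eta / 16%:R)) * (N%:R * 2%:R) <= 16%:R^-1.
  rewrite expRN mulrC ler_pdivrMr ?expR_gt0 //; lra.
rewrite -mulrA.
have := ler_pM (expR_ge0 _) _ e1 e2; rewrite mulr_ge0 ?expR_ge0 ?mulr_ge0 // => /(_ isT).
move=> /le_trans; apply; lra.
Qed.

(** The averaged inner product is the squared norm of the expected Gibbs vector,
which has a large product with the Gibbs vector of the true mean. *)
Lemma sampled_correlation (v0 : signed_column N) :
  8%:R^-1 <= mean_agreement v0 -> 32%:R * N%:R <= expR (eta / 16%:R) ->
  9%:R / 16%:R <= \sum_H \sum_H' sample_weight H * sample_weight H' *
    \sum_i gibbs_vector (sample_mean H) i * gibbs_vector (sample_mean H') i.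
Proof.
move=> mv0 large; set m := mean_agreement.
pose u (H : {ffun 'I_r -> Om}) := gibbs_vector (sample_mean H).
pose Eu i := \sum_H sample_weight H * u H i.
have -> : \sum_H \sum_H' sample_weight H * sample_weight H' *
    \sum_i gibbs_vector (sample_mean H) i * gibbs_vector (sample_mean H') i =
    \sum_i Eu i ^+ 2.
  under eq_bigr do under eq_bigr do rewrite mulr_sumr.
  under eq_bigr do rewrite exchange_big.
  rewrite exchange_big; apply: eq_bigr => i _; rewrite expr2 mulr_suml.
  apply: eq_bigr => H _; rewrite mulr_sumr; apply: eq_bigr => H' _.
  by rewrite mulrACA.
have dot : 3%:R / 4%:R <= \sum_i Eu i * gibbs_vector m i.
  have -> : \sum_i Eu i * gibbs_vector m i =
      \sum_H sample_weight H * \sum_i u H i * gibbs_vector m i.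
    under [RHS]eq_bigr do rewrite mulr_sumr.
    rewrite exchange_big; apply: eq_bigr => i _; rewrite mulr_suml.
    by apply: eq_bigr => H _; rewrite mulrA.
  under eq_bigr do rewrite gibbs_vector_dot mulrBr.
  rewrite sumrB; have := expected_overlap v0.
  have := expected_antipodal_overlap mv0 large; rewrite -/m; lra.
have sq : 0 <= \sum_i (Eu i - 3%:R / 4%:R * gibbs_vector m i) ^+ 2.
  by apply: sumr_ge0 => i _; exact: sqr_ge0.
have : \sum_i (Eu i - 3%:R / 4%:R * gibbs_vector m i) ^+ 2 =
   \sum_i Eu i ^+ 2 - 3%:R / 2%:R * (\sum_i Eu i * gibbs_vector m i) +
   9%:R / 16%:R * \sum_i gibbs_vector m i ^+ 2.
  rewrite !mulr_sumr -sumrB -big_split; apply: eq_bigr => i _ /=; lra.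
move=> e; rewrite e in sq; have := gibbs_vector_norm v0 m; lra.
Qed.
End Sampling.

(** * Random sign projections *)

Section Rademacher.
Variables (R : realType) (T : finType).

Definition rademacher (g : {ffun T -> bool}) (i : T) : R := if g i then 1 else -1.

Definition rademacher_sum (s : seq T) (u : T -> R) (g : {ffun T -> bool}) : R :=
  \sum_(i <- s) rademacher g i * u i.

Definition flip_coordinate (i : T) (g : {ffun T -> bool}) : {ffun T -> bool} :=
  [ffun j => if j == i then ~~ g j else g j].

Lemma flip_coordinateK i : involutive (flip_coordinate i).
Proof.
by move=> g; apply/ffunP => j; rewrite !ffunE; case: eqP => // _; rewrite negbK.
Qed.

(** Flipping the [i]-th sign negates the sum. *)
Lemma sum_rademacher_mul i (phi : {ffun T -> bool} -> R) :
  (forall g, phi (flip_coordinate i g) = phi g) ->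
  \sum_g rademacher g i * phi g = 0.
Proof.
move=> phiE; set S := \sum_g _.
have : S = - S.
  rewrite {1}/S (reindex_inj (inv_inj (flip_coordinateK i))) /S -sumrN.
  apply: eq_bigr => g _; rewrite phiE -mulNr /rademacher ffunE eqxx.
  by case: (g i); rewrite /= ?opprK.
lra.
Qed.

Lemma rademacher_sqr g i : rademacher g i ^+ 2 = 1.
Proof. by rewrite /rademacher; case: ifP; rewrite ?sqrrN expr1n. Qed.

Lemma rademacher_sum_flip s u i g : i \notin s ->
  rademacher_sum s u (flip_coordinate i g) = rademacher_sum s u g.
Proof.
move=> iNs; apply: eq_big_seq => j js; rewrite /rademacher ffunE.
by case: eqP => // ji; rewrite -ji js in iNs.
Qed.

Lemma rademacher_sum_dot s u v : uniq s ->
  \sum_g rademacher_sum s u g * rademacher_sum s v g =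
  #|{ffun T -> bool}|%:R * \sum_(i <- s) u i * v i.
Proof.
elim: s => [_|i s IH /andP[iNs us]].
  by rewrite big_nil mulr0 big1 // => g _; rewrite /rademacher_sum !big_nil mulr0.
rewrite big_cons mulrDr -(IH us).
have -> : \sum_g rademacher_sum (i :: s) u g * rademacher_sum (i :: s) v g =
  \sum_(g : {ffun T -> bool}) u i * v i +
  \sum_g rademacher g i * (u i * rademacher_sum s v g + v i * rademacher_sum s u g) +
  \sum_g rademacher_sum s u g * rademacher_sum s v g.
  rewrite -!big_split; apply: eq_bigr => g _ /=.
  rewrite /rademacher_sum !big_cons.
  have := rademacher_sqr g i; set e := rademacher g i => e1.
  by ring: e1.
rewrite sum_rademacher_mul ?addr0; last by move=> g; rewrite !rademacher_sum_flip.
by rewrite sumr_const mulr_natl.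
Qed.

(** In the expansion of the fourth power along the first coordinate, the terms of odd
degree in its sign cancel. *)
Lemma rademacher_sum_fourth s u : uniq s ->
  \sum_g rademacher_sum s u g ^+ 4 <=
  3%:R * #|{ffun T -> bool}|%:R * (\sum_(i <- s) u i ^+ 2) ^+ 2.
Proof.
elim: s => [_|i s IH /andP[iNs us]].
  rewrite big_nil expr0n mulr0 big1 // => g _.
  by rewrite /rademacher_sum big_nil expr0n.
rewrite big_cons; set S := \sum_(_ <- s) _; move: (IH us); rewrite -/S => IH'.
have -> : \sum_g rademacher_sum (i :: s) u g ^+ 4 =
  \sum_(g : {ffun T -> bool}) u i ^+ 4 +
  \sum_g rademacher g i * (4%:R * u i * rademacher_sum s u g ^+ 3 +
                           4%:R * u i ^+ 3 * rademacher_sum s u g) +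
  6%:R * u i ^+ 2 * (\sum_g rademacher_sum s u g * rademacher_sum s u g) +
  \sum_g rademacher_sum s u g ^+ 4.
  rewrite mulr_sumr -!big_split; apply: eq_bigr => g _ /=.
  rewrite /rademacher_sum big_cons -/(rademacher_sum s u g).
  have := rademacher_sqr g i; set e := rademacher g i => e1.
  by ring: e1.
rewrite sum_rademacher_mul ?addr0; last by move=> g; rewrite !rademacher_sum_flip.
rewrite sumr_const -mulr_natl rademacher_sum_dot //.
have -> : \sum_(j <- s) u j * u j = S by [].
have K0 : 0 <= #|{ffun T -> bool}|%:R :> R by [].
move: IH'; set K : R := #|_|%:R; set F := \sum_g _ => IH'.
have : 0 <= K * u i ^+ 4 by rewrite mulr_ge0 // exprn_even_ge0.
lra.
Qed.
End Rademacher.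

Section Clip.
Variable R : realType.

(** This is truncation to [[-4, 4]], rescaled to [[-1, 1]]. *)
Definition clip (x : R) : R := x / Num.max 4%:R `|x|.

Lemma clipN x : clip (- x) = - clip x.
Proof. by rewrite /clip normrN mulNr. Qed.

Lemma clip_norm x : `|clip x| <= 1.
Proof.
have p : 0 < Num.max 4%:R `|x| by rewrite lt_max ltr0n.
by rewrite /clip normrM normfV (gtr0_norm p) ler_pdivrMr // mul1r le_max lexx orbT.
Qed.

(** Truncation matters only when [x ^+ 2 + z ^+ 2 >= 16], and then the product is
dominated by the fourth powers. *)
Lemma clip_dot x z :
  (x * z - (x ^+ 4 + z ^+ 4) / 16%:R) / 16%:R <= clip x * clip z.
Proof.
have frac t : exists2 a, 0 <= a <= 1 & clip t = a * t / 4%:R.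
  have p : 0 < Num.max 4%:R `|t| by rewrite lt_max ltr0n.
  exists (4%:R / Num.max 4%:R `|t|); last by rewrite /clip; field; rewrite gt_eqF.
  by rewrite divr_ge0 ?(ltW p) //= ler_pdivrMr // mul1r le_max lexx.
have small t : `|t| <= 4%:R -> clip t = t / 4%:R by rewrite /clip => /max_idPl ->.
have fx : 0 <= x ^+ 4 by rewrite exprn_even_ge0.
have fz : 0 <= z ^+ 4 by rewrite exprn_even_ge0.
have [/andP[x4 z4]|big] := boolP ((`|x| <= 4%:R) && (`|z| <= 4%:R)).
  by rewrite !small // mulf_div; lra.
have sq : 16%:R <= x ^+ 2 + z ^+ 2.
  move: big; rewrite negb_and -!ltNge => /orP[] /ltW lt.
    have := ler_pM _ _ lt lt; rewrite -!expr2 real_normK ?num_real // => /(_ (ler0n _ _) (ler0n _ _)).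
    by have := sqr_ge0 z; lra.
  have := ler_pM _ _ lt lt; rewrite -!expr2 real_normK ?num_real // => /(_ (ler0n _ _) (ler0n _ _)).
  by have := sqr_ge0 x; lra.
have [a /andP[a0 a1] ->] := frac x; have [b /andP[b0 b1] ->] := frac z.
have main : x * z - (x ^+ 4 + z ^+ 4) / 16%:R <= (a * b) * (x * z).
  have ab1 : a * b <= 1 by rewrite mulr_ile1.
  have ab0 : 0 <= a * b by rewrite mulr_ge0.
  have e1 : (1 - a * b) * (x * z) <= (x ^+ 2 + z ^+ 2) / 2%:R.
    apply: le_trans (_ : (1 - a * b) * ((x ^+ 2 + z ^+ 2) / 2%:R) <= _).
      apply: ler_wpM2l; first lra.
      by have := sqr_ge0 (x - z); rewrite sqrrB; lra.
    rewrite ler_piMl //; last by lra.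
    by have := sqr_ge0 x; have := sqr_ge0 z; lra.
  have e2 : (x ^+ 2 + z ^+ 2) / 2%:R <= (x ^+ 4 + z ^+ 4) / 16%:R.
    have -> : x ^+ 4 = (x ^+ 2) ^+ 2 by rewrite -exprM.
    have -> : z ^+ 4 = (z ^+ 2) ^+ 2 by rewrite -exprM.
    move: (x ^+ 2) (z ^+ 2) sq => X Z sq; have := sqr_ge0 (X - Z).
    have : 0 <= (X + Z) * (X + Z - 16%:R) by rewrite mulr_ge0; lra.
    lra.
  lra.
by move: main; lra.
Qed.
End Clip.

(** Exponential moments and a union bound over [P]: the sum over [P] of the
exponential deviations has a small mean, so some sample keeps all of them small. *)
Lemma simultaneous_sampling (R : realType) (G P : finType) (y : G -> R)
    (X : G -> P -> R) (k : nat) :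
  (forall g, 0 <= y g) -> \sum_g y g = 1 -> (forall g p, `|X g p| <= 1) ->
  1024%:R ^+ 2 * ln (#|P|%:R : R) <= k%:R ->
  exists H : {ffun 'I_k -> G}, forall p,
    k%:R * (\sum_g y g * X g p - 256%:R^-1) <= \sum_l X (H l) p.
Proof.
move=> y0 y1 X1 kP; pose K p := \sum_g y g * X g p.
(* the slope balances the two error terms [ln #|P| / la] and [4 * la * k] *)
pose la : R := 2048%:R^-1.
have K1 p : `|K p| <= 1.
  apply: le_trans (ler_norm_sum _ _ _) _; rewrite -y1; apply: ler_sum => g _.
  by rewrite normrM (ger0_norm (y0 g)) ler_piMr.
have mgf p : \sum_g y g * expR (la * (K p - X g p)) <= expR (4%:R * la ^+ 2).
  apply: le_trans (expR_ge1Dx _).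
  have -> : 1 + 4%:R * la ^+ 2 =
      \sum_g y g * (1 + la * (K p - X g p) + 4%:R * la ^+ 2).
    rewrite (eq_bigr (fun g => y g * (1 + la * K p + 4%:R * la ^+ 2) -
      la * (y g * X g p))); last by move=> g _; ring.
    by rewrite sumrB -mulr_suml y1 -mulr_sumr -/(K p); ring.
  apply: ler_sum => g _; apply: ler_wpM2l => //.
  have := K1 p; have := X1 g p; rewrite !ler_norml => /andP[x1 x2] /andP[k1 k2].
  apply: le_trans (expR_le_quadratic _) _.
    by rewrite ler_norml /la; lra.
  rewrite lerD2l exprMn mulrC ler_wpM2r ?sqr_ge0 //.
  by move: (K p) (X g p) x1 x2 k1 k2 => a b *; nra.
pose Phi (H : {ffun 'I_k -> G}) := \sum_p \prod_l expR (la * (K p - X (H l) p)).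
have Phi_mean : \sum_H sample_weight y H * Phi H <=
    #|P|%:R * expR (4%:R * la ^+ 2) ^+ k.
  under eq_bigr do rewrite mulr_sumr.
  rewrite exchange_big /= mulr_natl -sumr_const; apply: ler_sum => p _.
  rewrite (sample_expectation_prod y (fun _ g => expR (la * (K p - X g p)))).
  rewrite prodr_const card_ord; apply: lerXn2r; rewrite ?nnegrE ?expR_ge0 //.
  by apply: sumr_ge0 => g _; rewrite mulr_ge0 ?expR_ge0.
have [H HP] : exists H, Phi H <= #|P|%:R * expR (4%:R * la ^+ 2) ^+ k.
  apply/not_existsP => bad.
  have := mean_gt (sample_weight_ge0 y0) (sample_weight_sum k y1)
    (fun H => ltac:(rewrite ltNge; exact/negP/(bad H))).
  by rewrite ltNge Phi_mean.
exists H => p; rewrite -/(K p).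
have P0 : 0 < #|P|%:R :> R by rewrite ltr0n; apply/card_gt0P; exists p.
have : expR (\sum_l la * (K p - X (H l) p)) <=
    expR (ln (#|P|%:R : R) + k%:R * (4%:R * la ^+ 2)).
  rewrite expRD lnK // expRM_natl; apply: le_trans HP.
  rewrite /Phi (bigD1 p) //= expR_sum lerDl sumr_ge0 // => *.
  by apply: prodr_ge0 => *; apply: expR_ge0.
rewrite ler_expR -mulr_sumr sumrB sumr_const card_ord -[K p *+ k]mulr_natl.
move: kP; rewrite /la.
lra.
Qed.

(** A random sign projection preserves inner products on average and has fourth
moment at most [3], so that clipping costs [(3 + 3) / 16]. *)
Lemma clipped_correlation (R : realType) (T : finType) (u v : T -> R)
    (G := #|{ffun T -> bool}|%:R : R) :
  \sum_i u i ^+ 2 <= 1 -> \sum_i v i ^+ 2 <= 1 ->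
  (\sum_i u i * v i - 6%:R / 16%:R) / 16%:R <=
  \sum_g G^-1 * (clip (rademacher_sum (index_enum T) u g) *
                 clip (rademacher_sum (index_enum T) v g)).
Proof.
move=> u1 v1.
have G0 : 0 < G by rewrite ltr0n; apply/card_gt0P; exists [ffun=> true].
have fourth (w : T -> R) : \sum_i w i ^+ 2 <= 1 ->
    \sum_g rademacher_sum (index_enum T) w g ^+ 4 <= 3%:R * G.
  move=> w1; apply: le_trans (rademacher_sum_fourth _ (index_enum_uniq _)) _.
  rewrite -[leRHS]mulr1; apply: ler_wpM2l; first by rewrite mulr_ge0 // ltW.
  by rewrite expr_le1 // sumr_ge0 // => i _; rewrite sqr_ge0.
set a := rademacher_sum _ u; set b := rademacher_sum _ v.
have dotE : \sum_g a g * b g = G * \sum_i u i * v i.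
  exact: (rademacher_sum_dot _ _ (index_enum_uniq _)).
apply: (@le_trans _ _ (\sum_g G^-1 *
    ((a g * b g - (a g ^+ 4 + b g ^+ 4) / 16%:R) / 16%:R))); last first.
  apply: ler_sum => g _; apply: ler_wpM2l; first by rewrite invr_ge0 ltW.
  exact: clip_dot.
rewrite -mulr_sumr -mulr_suml sumrB -mulr_suml big_split /= dotE.
rewrite mulrA ler_wpM2r // [leRHS]mulrC ler_pdivlMr //.
have := fourth u u1; have := fourth v v1; rewrite -/a -/b.
move: (\sum_g a g ^+ 4) (\sum_g b g ^+ 4) (\sum_i _) => A4 B4 D.
by move: (G) => g *; lra.
Qed.

(** * Separating forms *)

Section Reduction.
Variables (R : realType) (N : nat) (Om : finType) (h : Om -> 'I_N -> bool).
Variables (flip : Om -> Om) (eta : R) (r k : nat).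
Hypothesis flipE : forall w i, h (flip w) i = ~~ h w i.
Hypothesis eta1 : 1 <= eta.
Hypothesis etaN : 32%:R * N%:R <= expR (eta / 16%:R).
Hypothesis r_large : 4%:R * eta ^+ 2 <= r%:R.
Hypothesis k_gt0 : (0 < k)%N.
Hypothesis k_large : 1024%:R ^+ 2 * (2%:R * r%:R * ln (#|Om|%:R : R)) <= k%:R.

Definition sampled_form (b : {ffun 'I_r -> Om} -> R) (y : Om -> R) : R :=
  \sum_(H : {ffun 'I_r -> Om}) sample_weight y H * b H.

(** The sum of the squared forms is the average, over two independent samples, of the
empirical correlation of their clipped projections.  This is close to the true
correlation for all pairs of samples, and the latter is positive on average by
[sampled_correlation]: [9/16] exceeds the clipping cost [6/16]. *)
Lemma separating_forms : exists b : 'I_k -> {ffun 'I_r -> Om} -> R,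
  (forall l (H : {ffun 'I_r -> Om}), b l [ffun j => flip (H j)] = - b l H) /\
  (forall y : Om -> R, (forall w, 0 <= y w) -> \sum_w y w = 1 ->
    (exists v, 8%:R^-1 <= mean_agreement h y v) ->
    0 < \sum_l sampled_form (b l) y ^+ 2).
Proof.
pose u (H : {ffun 'I_r -> Om}) := gibbs_vector eta (sample_mean R h H).
pose a H (g : {ffun 'I_N -> bool}) := rademacher_sum (index_enum 'I_N) (u H) g.
pose c H g := clip (a H g).
pose G := #|{ffun 'I_N -> bool}|%:R : R.
have G0 : 0 < G by rewrite ltr0n; apply/card_gt0P; exists [ffun=> true].
pose X g (p : {ffun 'I_r -> Om} * {ffun 'I_r -> Om}) := c p.1 g * c p.2 g.
have [||||gs gsP] := @simultaneous_sampling R _ _ (fun=> G^-1) X k.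
- by move=> _; rewrite invr_ge0 ltW.
- by rewrite sumr_const -mulr_natl -/G divff // gt_eqF.
- by move=> g p; rewrite normrM mulr_ile1 // clip_norm.
- rewrite card_prod !card_ffun card_ord; apply: le_trans k_large.
  apply: (ler_wpM2l (sqr_ge0 _)).
  have [Om0|Om0] := posnP #|Om|.
    rewrite Om0 [X in _ <= _ * X]ln0 // mulr0; apply: ln_le0.
    by rewrite lern1; case: (posnP r) => [->|r0]; rewrite ?expn0 ?exp0n.
  by rewrite natrM natrX -exprD addnn -mul2n lnXn ?ltr0n // -[leLHS]mulr_natl natrM.
exists (fun l H => c H (gs l)); split.
  move=> l H; rewrite /c -clipN /a /rademacher_sum -sumrN; congr clip.
  apply: eq_bigr => i _; rewrite -mulrN; congr (_ * _); rewrite /u.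
  apply: gibbs_vector_odd => v; rewrite /sample_mean; congr (_ / _).
  apply: eq_bigr => j _; rewrite ffunE agreement_antipode.
  by rewrite /agreement flipE; case: (h _ _); case: v.2; rewrite ?opprK.
move=> y y0 y1 [v0 yv0].
have K_ge H H' : (\sum_i u H i * u H' i - 6%:R / 16%:R) / 16%:R <=
    \sum_g G^-1 * X g (H, H').
  by apply: clipped_correlation; exact: gibbs_vector_norm v0 _.
rewrite /sampled_form.
have -> : \sum_l (\sum_H sample_weight y H * c H (gs l)) ^+ 2 =
  \sum_H \sum_H' sample_weight y H * sample_weight y H' *
    \sum_l X (gs l) (H, H').
  under [RHS]eq_bigr do under eq_bigr do rewrite mulr_sumr.
  under [RHS]eq_bigr do rewrite exchange_big.
  rewrite [RHS]exchange_big; apply: eq_bigr => l _; rewrite expr2 mulr_suml.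
  apply: eq_bigr => H _; rewrite mulr_sumr; apply: eq_bigr => H' _.
  by rewrite /X mulrACA.
have W0 := sample_weight_ge0 y0; have W1 := sample_weight_sum r y1.
have S := sampled_correlation y0 y1 eta1 r_large yv0 etaN.
apply: (@lt_le_trans _ _ (\sum_H \sum_H' sample_weight y H * sample_weight y H' *
    (k%:R * ((\sum_i u H i * u H' i - 6%:R / 16%:R) / 16%:R - 256%:R^-1)))); last first.
  apply: ler_sum => H _; apply: ler_sum => H' _.
  apply: ler_wpM2l; first by rewrite mulr_ge0.
  apply: le_trans (gsP (H, H')); apply: ler_wpM2l => //.
  by rewrite lerD2r K_ge.
have -> : \sum_H \sum_H' sample_weight y H * sample_weight y H' *
    (k%:R * ((\sum_i u H i * u H' i - 6%:R / 16%:R) / 16%:R - 256%:R^-1)) =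
  k%:R / 16%:R * (\sum_H \sum_H' sample_weight y H * sample_weight y H' *
     \sum_i u H i * u H' i) - k%:R * (7%:R / 256%:R).
  have -> : k%:R * (7%:R / 256%:R) =
      \sum_(H : {ffun 'I_r -> Om}) \sum_(H' : {ffun 'I_r -> Om})
      sample_weight y H * sample_weight y H' * (k%:R * (7%:R / 256%:R)) :> R.
    move: (k%:R * _) => e; rewrite -[LHS]mul1r -W1 mulr_suml.
    apply: eq_bigr => H _; by rewrite -mulr_suml -mulr_sumr W1 mulr1.
  rewrite mulr_sumr -sumrB; apply: eq_bigr => H _.
  rewrite mulr_sumr -sumrB; apply: eq_bigr => H' _; by field.
have kp : 0 < k%:R :> R by rewrite ltr0n.
move: S; rewrite -/u; move: (\sum_H _) (k%:R : R) kp => D kk kp DS; nra.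
Qed.
End Reduction.

(** * Odd functions without common zeros *)

Section Continuity.
Variables (R : realType) (T : topologicalType).

Lemma continuous_at_sum (I : finType) (P : pred I) (F : I -> T -> R) (x : T) :
  (forall i, P i -> {for x, continuous (F i)}) ->
  {for x, continuous (fun t => \sum_(i | P i) F i t)}.
Proof. by move=> Fc; apply: cvg_big => //; exact: add_continuous. Qed.

Lemma continuous_at_prod (I : finType) (P : pred I) (F : I -> T -> R) (x : T) :
  (forall i, P i -> {for x, continuous (F i)}) ->
  {for x, continuous (fun t => \prod_(i | P i) F i t)}.
Proof. by move=> Fc; apply: cvg_big => //; exact: mul_continuous. Qed.

Lemma continuous_at_row (n : nat) (F : T -> 'rV[R]_n) (x : T) :
  (forall i, {for x, continuous (fun t => F t ord0 i)}) ->
  {for x, continuous F}.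
Proof.
move=> Fc B [P PF PB].
have : \forall t \near x, forall i, P ord0 i (F t ord0 i).
  by apply: filter_forall => i; apply: Fc; exact: PF.
by apply: filterS => t Pt; apply: PB => i j; rewrite ord1.
Qed.

(** Normalizing an odd map without zeros gives an equivariant map to the sphere. *)
Lemma ind_le (X : set T) (nu : T -> T) (k : nat) (F : 'I_k.+1 -> T -> R) :
  (forall x, X x -> X (nu x)) ->
  (forall i x, X x -> {for x, continuous (F i)}) ->
  (forall i x, X x -> F i (nu x) = - F i x) ->
  (forall x, X x -> 0 < \sum_i F i x ^+ 2) ->
  (ind R X nu <= (k%:R)%:E)%E.
Proof.
move=> Xnu Fc Fodd Fpos; rewrite /ind; case: ifPn => [_|].
  by rewrite -EFinN lee_fin; apply: le_trans (ler0n _ _).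
move=> /asboolPn X0; apply: ereal_inf_lbound; exists k => //.
pose S x := Num.sqrt (\sum_i F i x ^+ 2).
have S0 x : X x -> S x != 0 by move=> Xx; rewrite gt_eqF // sqrtr_gt0 Fpos.
exists (fun x => \row_i (F i x / S x)); split.
- apply: continuous_in_subspaceT => x /set_mem Xx; apply: continuous_at_row => i.
  rewrite (_ : (fun t => _) = (fun t => F i t * (S t)^-1)); last first.
    by apply: funext => t; rewrite mxE.
  apply: continuousM; first exact: Fc.
  apply: continuousV; first exact: S0.
  apply: continuous_comp; last exact: sqrt_continuous.
  apply: continuous_at_sum => j _.
  rewrite (_ : (fun t => _) = (fun t => F j t * F j t)); last first.
    by apply: funext => t; rewrite expr2.
  by apply: continuousM; exact: Fc.
- move=> x Xx; rewrite /sphere /=.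
  under eq_bigr do rewrite mxE exprMn.
  rewrite -mulr_suml exprVn sqr_sqrtr ?ltW ?Fpos // divff // gt_eqF //.
  exact: Fpos.
- move=> x Xx; apply/rowP => i; rewrite !mxE.
  have -> : S (nu x) = S x.
    by congr Num.sqrt; apply: eq_bigr => j _; rewrite Fodd // sqrrN.
  by rewrite Fodd // mulNr.
Qed.
End Continuity.

(** * Margins on faces *)

Lemma mean_agreement_flip (R : realType) (N : nat) (Om : finType)
    (h : Om -> 'I_N -> bool) (flip : Om -> Om) (y : Om -> R) v :
  involutive flip -> (forall w i, h (flip w) i = ~~ h w i) ->
  mean_agreement h (fun w => y (flip w)) v = mean_agreement h y (antipode v).
Proof.
move=> flipK flipE; rewrite /mean_agreement (reindex_inj (inv_inj flipK)).
apply: eq_bigr => w _; rewrite flipK agreement_antipode; congr (_ * _).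
by rewrite /agreement flipE; case: (h w _); case: v.2; rewrite ?opprK.
Qed.

Lemma sign_complex_antipode (M N : nat) (A : 'M[partial_sign]_(M, N)) s :
  s \in sign_complex A -> (antipode @: s)%SET \in sign_complex A.
Proof.
rewrite !inE => /andP[s0 /existsP[r sr]]; rewrite imset_eq0 s0 /=.
apply/existsP; exists r; rewrite orbC; case/orP: sr => sr; apply/orP.
  by left; apply: imsetS.
right; apply: (fintype.subset_trans (imsetS _ sr)).
apply/fintype.subsetP => _ /imsetP[_ /imsetP[w wr ->] ->].
by rewrite antipodeK.
Qed.

Section SignedHalving.
Variables (R : realType) (M N : nat) (A : 'M[partial_sign]_(M, N)).
Let n := (32 * VC A)%N.

Definition halving_index : finType := ({ffun 'I_n -> signed_column N} * 'I_n)%type.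

Definition signed_halving (w : halving_index * bool) (i : 'I_N) : bool :=
  halving A w.1.1 w.1.2 i == w.2.

Definition negate_halving (w : halving_index * bool) : halving_index * bool :=
  (w.1, ~~ w.2).

Lemma negate_halvingK : involutive negate_halving.
Proof. by case=> c b; rewrite /negate_halving /= negbK. Qed.

Lemma signed_halving_negate w i :
  signed_halving (negate_halving w) i = ~~ signed_halving w i.
Proof. by rewrite /signed_halving /=; case: (halving _ _ _ _); case: w.2. Qed.

(** Both kinds of faces are treated by boosting on a subset of [sigma_pos A r]; for a
face of [sigma_neg A r] all predictors are negated. *)
Lemma face_margin (s : {set signed_column N}) :
  (0 < VC A)%N -> s \in sign_complex A ->
  exists y : halving_index * bool -> R,
    [/\ forall w, 0 <= y w, \sum_w y w = 1 &
      forall v, v \in s -> 8%:R^-1 <= mean_agreement signed_halving y v].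
Proof.
move=> d0; rewrite inE => /andP[s0 /existsP[r sr]].
have pos t : t != finset.set0 -> t \subset sigma_pos A r ->
    exists y : halving_index * bool -> R,
    [/\ forall w, 0 <= y w, \sum_w y w = 1 &
      forall v, v \in t -> 8%:R^-1 <= mean_agreement signed_halving y v].
  move=> t0 /fintype.subsetP tr.
  have [|||y [y0 y1 ym]] := @boosting R _ halving_index t
    (fun c v => agreement R (fun c : halving_index => halving A c.1 c.2) c v).
  - by move=> c v; rewrite agreement_norm.
  - by rewrite card_gt0.
  - move=> q q0 q1 qt.
    have [c cq] := weak_learner d0 q0 q1 (fun v qv => tr _ (qt v qv)).
    exists c; rewrite (eq_bigr (fun v => q v -
        2%:R * (q v * (halving A c.1 c.2 v.1 != v.2)%:R))).
      by rewrite sumrB -mulr_sumr q1; lra.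
    by move=> v _; rewrite /agreement; case: eqP => _ /=; ring.
  exists (fun w => if w.2 then y w.1 else 0); split.
  - by move=> w; case: ifP.
  - rewrite -y1 -(pair_bigA _ (fun c (b : bool) => if b then y c else 0)) /=.
    by apply: eq_bigr => c _; rewrite big_bool /= addr0.
  move=> v vt; apply: le_trans (ym v vt) _; rewrite /mean_agreement.
  rewrite -(pair_bigA _ (fun c (b : bool) => (if b then y c else 0) *
    agreement R signed_halving (c, b) v)) /=.
  apply: ler_sum => c _; rewrite big_bool /= mul0r addr0.
  by rewrite /agreement /signed_halving /= eqb_id.
case/orP: sr => sr; first exact: pos.
have [||y [y0 y1 ym]] := pos (antipode @: s)%SET.
- by rewrite imset_eq0.
- apply: (fintype.subset_trans (imsetS _ sr)); apply/fintype.subsetP => v.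
  by move=> /imsetP[_ /imsetP[w wr ->] ->]; rewrite antipodeK.
exists (fun w => y (negate_halving w)); split => //.
  by rewrite -y1 [RHS](reindex_inj (inv_inj negate_halvingK)).
move=> v vs; rewrite (mean_agreement_flip _ _ negate_halvingK signed_halving_negate).
by apply: ym; rewrite imset_f.
Qed.
End SignedHalving.

Section Selection.
Variables (R : realType) (N : nat) (Om : finType) (h : Om -> 'I_N -> bool).
Variables (flip : Om -> Om) (K : {set {set signed_column N}}).
Hypothesis flipK : involutive flip.
Hypothesis flipE : forall w i, h (flip w) i = ~~ h w i.
Hypothesis K_antipode : forall s, s \in K -> (antipode @: s)%SET \in K.
Hypothesis margin : forall s, s \in K -> exists y : Om -> R,
    [/\ forall w, 0 <= y w, \sum_w y w = 1 &
      forall v, v \in s -> 8%:R^-1 <= mean_agreement h y v].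

(** The margin condition is convex, so an arbitrary choice can be averaged with its
reflection. *)
Lemma odd_face_selection : exists y : {set signed_column N} -> Om -> R,
  forall s, s \in K ->
  [/\ forall w, 0 <= y s w, \sum_w y s w = 1,
      forall v, v \in s -> 8%:R^-1 <= mean_agreement h (y s) v &
      forall w, y (antipode @: s)%SET w = y s (flip w)].
Proof.
have ex s : exists y : Om -> R, s \in K ->
    [/\ forall w, 0 <= y w, \sum_w y w = 1 &
      forall v, v \in s -> 8%:R^-1 <= mean_agreement h y v].
  have [/margin[y yP]|sK] := boolP (s \in K); first by exists y.
  by exists (fun=> 0).
have [Y YP] := choice ex.
exists (fun s w => (Y s w + Y (antipode @: s)%SET (flip w)) / 2%:R) => s sK.
have [a0 a1 am] := YP _ sK; have [b0 b1 bm] := YP _ (K_antipode sK).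
split.
- by move=> w; rewrite divr_ge0 // addr_ge0.
- rewrite -mulr_suml big_split /= a1.
  have -> : \sum_w Y (antipode @: s)%SET (flip w) = 1.
    by rewrite -b1 [RHS](reindex_inj (inv_inj flipK)).
  lra.
- move=> v vs.
  have -> : mean_agreement h (fun w => (Y s w + Y (antipode @: s)%SET (flip w)) / 2%:R) v =
     (mean_agreement h (Y s) v +
      mean_agreement h (Y (antipode @: s)%SET) (antipode v)) / 2%:R.
    rewrite -(mean_agreement_flip _ _ flipK flipE) /mean_agreement -big_split mulr_suml.
    by apply: eq_bigr => w _ /=; ring.
  have := am v vs; have := bm (antipode v) (imset_f _ vs); lra.
move=> w; rewrite flipK addrC; congr ((Y _ _ + _) / _).
rewrite -imset_comp (eq_imset (g := id)) ?imset_id // => v.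
exact: antipodeK.
Qed.
End Selection.

(** * Gluing over superlevel sets *)

Section LevelSets.
Variables (R : realType) (N : nat).
Implicit Types (s : {set signed_column N}).

(** Depends continuously on [x] and vanishes unless [s]
is a superlevel set of [x]. *)
Definition level_weight s (x : {ptws signed_column N -> R}) : R :=
  \prod_(v in s) \prod_(u | u \notin s) Num.max 0 (x v - x u).

Lemma level_weight_ge0 s x : 0 <= level_weight s x.
Proof.
apply: prodr_ge0 => v _; apply: prodr_ge0 => u _.
by rewrite le_max lexx.
Qed.

Lemma level_weight_max s x v0 :
  s != finset.set0 -> (forall u, x u <= x v0) -> level_weight s x != 0 -> v0 \in s.
Proof.
move=> /set0Pn[v vs] xmax; apply: contraR => v0s.
rewrite /level_weight (bigD1 v) //= (bigD1 v0) //= max_l ?subr_le0 //.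
by rewrite !mul0r.
Qed.

Lemma level_weight_top x v0 : level_weight [set v | x v0 <= x v]%SET x != 0.
Proof.
apply/prodf_neq0 => v; rewrite inE => xv; apply/prodf_neq0 => u; rewrite inE -ltNge => xu.
by rewrite gt_eqF // lt_max subr_gt0 (lt_le_trans xu xv) orbT.
Qed.

Lemma level_weight_antipode s x :
  level_weight (antipode @: s)%SET (realization_antipode R N x) = level_weight s x.
Proof.
have aK := @antipodeK N.
have mem_antipode v : (antipode v \in (antipode @: s)%SET) = (v \in s).
  by apply: mem_imset; exact: inv_inj.
rewrite /level_weight (reindex_inj (inv_inj aK)) /=.
apply: eq_big => [v|v _]; first by rewrite mem_antipode.
rewrite (reindex_inj (inv_inj aK)) /=.
apply: eq_big => [u|u _]; first by rewrite mem_antipode.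
by rewrite /realization_antipode !aK.
Qed.

Lemma coordinate_continuous (v : signed_column N) :
  continuous (fun x : {ptws signed_column N -> R} => x v).
Proof. exact: (@proj_continuous _ (fun _ : signed_column N => R) v). Qed.

Lemma level_weight_continuous s : continuous (level_weight s).
Proof.
move=> x; apply: continuous_at_prod => v _; apply: continuous_at_prod => u _.
apply: (@continuous_max R _ (fun=> 0) (fun x : {ptws signed_column N -> R} => x v - x u)).
  exact: cst_continuous.
by apply: continuousB; exact: coordinate_continuous.
Qed.
End LevelSets.

Section IndexBound.
Variables (R : realType) (M N : nat) (A : 'M[partial_sign]_(M, N)).
Variables (Om : finType) (h : Om -> 'I_N -> bool) (flip : Om -> Om).
Variables (eta : R) (r k : nat).
Let K := sign_complex A.
Hypothesis flipK : involutive flip.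
Hypothesis flipE : forall w i, h (flip w) i = ~~ h w i.
Hypothesis margin : forall s, s \in K -> exists y : Om -> R,
    [/\ forall w, 0 <= y w, \sum_w y w = 1 &
      forall v, v \in s -> 8%:R^-1 <= mean_agreement h y v].
Hypothesis eta1 : 1 <= eta.
Hypothesis etaN : 32%:R * N%:R <= expR (eta / 16%:R).
Hypothesis r_large : 4%:R * eta ^+ 2 <= r%:R.
Hypothesis k_large :
  1024%:R ^+ 2 * (2%:R * r%:R * ln (#|Om|%:R : R)) <= k.+1%:R.

(** The mixture [Y x] is a probability distribution because the set of vertices of
maximal coordinate is a face with positive weight; every face of nonzero weight
contains such a vertex, so the margin survives there. *)
Lemma ind_le_of_margin :
  (ind R (realization R K) (realization_antipode R N) <= (k%:R)%:E)%E.
Proof.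
have K0 s : s \in K -> s != finset.set0 by rewrite inE => /andP[].
have [y yP] := odd_face_selection flipK flipE (@sign_complex_antipode M N A) margin.
have [b [bodd bpos]] :=
  separating_forms (k := k.+1) flipE eta1 etaN r_large isT k_large.
have [_ inv] := sign_complex_free_involution R A.
pose W (x : {ptws signed_column N -> R}) := \sum_(s in K) level_weight s x.
pose Y (x : {ptws signed_column N -> R}) (w : Om) :=
  (\sum_(s in K) level_weight s x * y s w) / W x.
have top x : realization R K x -> exists2 v0, forall u, x u <= x v0 & 0 < W x.
  move=> [x0 x1 xK].
  have [v00 xv00] : exists v, x v != 0.
    have /set0Pn[v] := K0 _ xK; rewrite inE => xv; by exists v.
  case: (@Order.TotalTheory.arg_maxP _ _ _ v00 predT x) => // v0 _ vmax.
  exists v0; first by move=> u; exact: vmax.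
  have topK : [set v | x v0 <= x v]%SET \in K.
    move: xK; rewrite !inE => /andP[_ /existsP[r0 sr]]; apply/andP; split.
      by apply/set0Pn; exists v0; rewrite inE.
    apply/existsP; exists r0; suff sub : [set v | x v0 <= x v]%SET \subset [set v | x v != 0]%SET.
      by case/orP: sr => sr; rewrite (fintype.subset_trans sub sr) ?orbT.
    apply/fintype.subsetP => v; rewrite !inE => xv; rewrite gt_eqF //.
    apply: lt_le_trans xv; apply: lt_le_trans (vmax v00 isT).
    by rewrite lt_def xv00 x0.
  rewrite /W (bigD1 _ topK) /= ltr_pwDl //.
    by rewrite lt_def level_weight_top level_weight_ge0.
  by apply: sumr_ge0 => s _; exact: level_weight_ge0.
have Yc w x : realization R K x -> {for x, continuous (Y^~ w)}.
  move=> /top[v0 _ Wx]; apply: continuousM.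
    apply: continuous_at_sum => s _; apply: continuousM; last exact: cst_continuous.
    exact: level_weight_continuous.
  apply: continuousV; first by rewrite gt_eqF.
  by apply: continuous_at_sum => s _; exact: level_weight_continuous.
have Ka (s : {set signed_column N}) : ((antipode @: s)%SET \in K) = (s \in K).
  apply/idP/idP; last exact: sign_complex_antipode.
  move=> /sign_complex_antipode; rewrite -imset_comp (eq_imset (g := id)) ?imset_id //.
  exact: antipodeK.
have aI : injective (fun s : {set signed_column N} => (antipode @: s)%SET).
  by apply: imset_inj; exact/inv_inj/antipodeK.
have Yodd x w : Y (realization_antipode R N x) w = Y x (flip w).
  rewrite /Y /W; congr (_ / _).
    rewrite (reindex_inj aI) /=; apply: eq_big => // s; rewrite Ka => sK.
    by rewrite level_weight_antipode; have [_ _ _ ->] := yP _ sK.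
  rewrite (reindex_inj aI) /=; apply: eq_big => // s _.
  by rewrite level_weight_antipode.
apply: (ind_le (F := fun l x => sampled_form (b l) (Y x))).
- by move=> x /inv[].
- move=> l x Xx; apply: continuous_at_sum => H _; apply: continuousM.
    by apply: continuous_at_prod => j _; exact: Yc.
  exact: cst_continuous.
- move=> l x Xx; rewrite /sampled_form -sumrN.
  have fI : injective (fun H : {ffun 'I_r -> Om} => [ffun j => flip (H j)]).
    move=> H H' /ffunP e; apply/ffunP => j; have := e j; rewrite !ffunE.
    exact/inv_inj.
  rewrite (reindex_inj fI) /=; apply: eq_bigr => H _.
  rewrite bodd mulrN; congr (- (_ * _)).
  by apply: eq_bigr => j _; rewrite Yodd ffunE flipK.
move=> x Xx; have [v0 vmax Wx] := top x Xx; apply: bpos.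
- move=> w; rewrite divr_ge0 ?(ltW Wx) // sumr_ge0 // => s sK.
  by rewrite mulr_ge0 ?level_weight_ge0 //; have [->] := yP _ sK.
- rewrite -mulr_suml exchange_big /= (eq_bigr (fun s => level_weight s x)).
    by rewrite divff // gt_eqF.
  by move=> s sK; rewrite -mulr_sumr; have [_ -> _ _] := yP _ sK; rewrite mulr1.
exists v0; have -> : mean_agreement h (Y x) v0 =
    (\sum_(s in K) level_weight s x * mean_agreement h (y s) v0) / W x.
  rewrite /mean_agreement /Y; under eq_bigr do rewrite mulrAC mulr_suml.
  rewrite -mulr_suml exchange_big /=; congr (_ / _); apply: eq_bigr => s _.
  by rewrite mulr_sumr; apply: eq_bigr => w _; rewrite mulrA.
rewrite ler_pdivlMr // mulr_sumr; apply: ler_sum => s sK.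
have [->|ws] := eqVneq (level_weight s x) 0; first by rewrite mulr0 mul0r.
rewrite mulrC; apply: ler_wpM2l; first exact: level_weight_ge0.
have [_ _ ym _] := yP _ sK; apply: ym.
exact: level_weight_max (K0 _ sK) vmax ws.
Qed.
End IndexBound.

(** * The bound *)

(** No column carries both signs, so each column has a preferred sign; the faces in
[sigma_pos] consist of preferred vertices and those in [sigma_neg] of their
antipodes. *)
Lemma ind_le0_of_VC0 (R : realType) (M N : nat) (A : 'M[partial_sign]_(M, N)) :
  VC A = 0%N ->
  (ind R (realization R (sign_complex A)) (realization_antipode R N) <= 0%:E)%E.
Proof.
move=> VC0.
pose e (v : signed_column N) : R :=
  if [exists r, A r v.1 == Some true] then (if v.2 then 1 else -1)
  else (if v.2 then -1 else 1).
have e_antipode v : e (antipode v) = - e v.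
  by rewrite /e /=; case: ifP => _; case: v.2; rewrite ?opprK.
have e_pos r v : v \in sigma_pos A r -> e v = 1.
  rewrite inE /e => /eqP; case: v => i [] /= ri.
    by case: existsP => // -[]; exists r; rewrite ri.
  case: existsP => // -[r' /eqP r'i].
  suff /(leq_bigmax_cond (F := fun D : {set 'I_N} => #|D|)) : shattered A [set i]%SET.
    by rewrite -/(VC A) VC0 cards1.
  apply/forallP => p; apply/existsP; exists (if p i then r' else r).
  apply/forallP => j; apply/implyP; rewrite inE => /eqP ->.
  by case: (p i); rewrite ?ri ?r'i.
have [_ inv] := sign_complex_free_involution R A.
apply: (ind_le (k := 0)
  (F := fun _ (x : {ptws signed_column N -> R}) => \sum_v x v * e v)).
- by move=> x /inv[].
- move=> _ x _; apply: continuous_at_sum => v _; apply: continuousM.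
    exact: coordinate_continuous.
  exact: cst_continuous.
- move=> _ x _; rewrite -sumrN (reindex_inj (inv_inj (@antipodeK N))) /=.
  apply: eq_bigr => v _; rewrite /realization_antipode antipodeK e_antipode.
  by rewrite mulrN.
move=> x [x0 x1]; rewrite inE => /andP[_ /existsP[r sr]].
rewrite big_ord1 lt_def sqr_ge0 andbT sqrf_eq0.
have supp v : x v != 0 -> v \in [set v | x v != 0]%SET by rewrite inE.
case/orP: sr => /fintype.subsetP sr.
  rewrite (eq_bigr x) ?x1 ?oner_eq0 // => v _.
  have [->|/supp/sr/e_pos ->] := eqVneq (x v) 0; first by rewrite mul0r.
  by rewrite mulr1.
rewrite (eq_bigr (fun v => - x v)) ?sumrN ?x1 ?oppr_eq0 ?oner_eq0 // => v _.
have [->|/supp/sr/imsetP[u /e_pos ue ->]] := eqVneq (x v) 0.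
  by rewrite mul0r oppr0.
by rewrite e_antipode ue mulrN1.
Qed.

Theorem corollary14 (R : realType) :
  exists C : R, 0 < C /\
    forall (M N : nat) (A : 'M[partial_sign]_(M, N)) (d : nat),
      (1 <= M)%N -> (2 <= N)%N -> VC A = d ->
      (ind R (realization R (sign_complex A)) (realization_antipode R N)
        <= (C * d%:R * (ln (N%:R : R)) ^+ 3)%:E)%E.
Proof.
have [c cE] : exists c : R, c = 1024%:R ^+ 2 by exists (1024%:R ^+ 2).
have [c' c'E] : exists c' : R, c' = 1024%:R * 97%:R ^+ 2.
  by exists (1024%:R * 97%:R ^+ 2).
have c0 : 0 < c by rewrite cE; lra.
have c'0 : 0 < c' by rewrite c'E; lra.
exists (c * c'); split; first exact: mulr_gt0.
move=> M N A d _ N2 dE.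
have [d0|d0] := posnP d.
  by rewrite d0 mulr0 mul0r; apply: ind_le0_of_VC0; rewrite dE.
pose L := ln ((2 * N)%:R : R).
have N0 : (0 < N)%N by apply: leq_trans N2.
have NN0 : 0 < N%:R :> R by rewrite ltr0n.
have N20 : 0 < (2 * N)%:R :> R by rewrite ltr0n muln_gt0.
have N4 : 4%:R <= (2 * N)%:R :> R by rewrite ler_nat (leq_mul2l 2 2).
have L1 : 1 <= L.
  rewrite -ler_expR lnK ?posrE //; apply: le_trans N4.
  have -> : expR 1 = expR 3%:R^-1 ^+ 3 :> R.
    by rewrite -expRM_natl divff // pnatr_eq0.
  have e3 : expR 3%:R^-1 <= 13%:R / 9%:R :> R.
    by apply: le_trans (expR_le_quadratic _) _; rewrite ?ger0_norm; lra.
  apply: le_trans (_ : (13%:R / 9%:R) ^+ 3 <= _); last lra.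
  by apply: lerXn2r; rewrite ?nnegrE ?expR_ge0 //; lra.
have L2 : L <= 2%:R * ln (N%:R : R).
  rewrite mulr_natl -lnXn // /L ler_ln ?posrE ?exprn_gt0 // -natrX ler_nat.
  by rewrite -mulnn leq_mul2r N2 orbT.
(* then [expR (eta / 16) = (2 N) ^ 3], which dominates [32 N] *)
pose eta := 48%:R * L.
have eta1 : 1 <= eta by rewrite /eta; lra.
have etaN : 32%:R * N%:R <= expR (eta / 16%:R).
  have -> : expR (eta / 16%:R) = (2 * N)%:R ^+ 3.
    rewrite -[X in X ^+ 3](lnK (x := _%:R)) ?posrE // -expRM_natl; congr expR.
    by rewrite /eta -/L; lra.
  have -> : 32%:R * N%:R = 16%:R * (2 * N)%:R :> R by rewrite natrM; ring.
  move: N4; move: ((2 * N)%:R : R) => z z4; nra.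
pose r := (Num.truncn (4%:R * eta ^+ 2)).+1.
have e0 : 0 <= 4%:R * eta ^+ 2 by rewrite mulr_ge0 // sqr_ge0.
have r_large : 4%:R * eta ^+ 2 <= r%:R by rewrite ltW // truncnS_gt.
have r_small : r%:R <= 97%:R ^+ 2 * L ^+ 2.
  rewrite /r -natr1; have := truncn_le (4%:R * eta ^+ 2); rewrite e0 => le.
  apply: le_trans (lerD le (lexx 1)) _; rewrite /eta; nra.
pose Om : finType := (halving_index A * bool)%type.
have lnOm : ln (#|Om|%:R : R) <= 64%:R * d%:R * L.
  rewrite !card_prod card_ffun card_prod !card_ord card_bool.
  rewrite dE; set n := (32 * d)%N.
  have n0 : (0 < n)%N by rewrite muln_gt0.
  have -> : 64%:R * d%:R * L = ln ((2 * N)%:R ^+ (n + n) : R).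
    rewrite lnXn // -/L -[RHS]mulr_natl natrD /n natrM; ring.
  rewrite ler_ln ?posrE ?exprn_gt0 //; last first.
    by rewrite ltr0n !muln_gt0 expn_gt0 muln_gt0 N0 ?n0 ?d0.
  rewrite -natrX ler_nat expnD -mulnA mulnC (mulnC N 2) leq_mul2r.
  apply/orP; right; apply: (@leq_trans (4 ^ n)).
    rewrite (expnMn 2 2) leq_mul //; first exact/ltnW/ltn_expl.
    by rewrite -[X in (X <= _)%N]expn1 leq_exp2l.
  by rewrite leq_exp2r // (leq_mul2l 2 2).
pose B := c * (2%:R * r%:R * ln (#|Om|%:R : R)).
have Om1 : (0 < #|Om|)%N.
  rewrite !card_prod card_ffun card_prod !card_ord card_bool dE.
  by rewrite !muln_gt0 expn_gt0 muln_gt0 N0 d0.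
have B0 : 0 <= B.
  by rewrite mulr_ge0 ?(ltW c0) // !mulr_ge0 // ln_ge0 // ler1n.
apply: (@le_trans _ _ ((Num.truncn B)%:R)%:E).
  apply: (ind_le_of_margin (negate_halvingK (A := A))
    (signed_halving_negate (A := A)) _ eta1 etaN r_large _).
    by move=> s sK; apply: face_margin => //; rewrite dE.
  by rewrite -cE ltW // truncnS_gt.
rewrite lee_fin; apply: le_trans (_ : B <= _); first by rewrite truncn_le.
rewrite /B -!mulrA; apply: ler_wpM2l; first exact: ltW.
have lnOm0 : 0 <= ln (#|Om|%:R : R) by rewrite ln_ge0 // ler1n.
have rO := ler_pM (ler0n R r) lnOm0 r_small lnOm.
have L3 : L ^+ 3 <= 8%:R * ln (N%:R : R) ^+ 3.
  have -> : 8%:R * ln (N%:R : R) ^+ 3 = (2%:R * ln (N%:R : R)) ^+ 3 by ring.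
  by apply: lerXn2r; rewrite ?nnegrE //; lra.
have := ler_wpM2l (ler0n R d) L3.
move: rO; rewrite c'E; move: (ln _) (ln _) (r%:R) (d%:R : R) (L) => lO lN r' d' L' *.
lra.
Qed.
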